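(* Let $R$ be a Noetherian integral domain and consider the following statements: (1) $R$ is Clifford $t$-regular; (2) each $t$-ideal $I$ of $R$ is $t$-invertible in $(I:I)$; (3) each $t$-ideal of $R$ is $L$-stable. Then $(1) \Longrightarrow (2) \Longrightarrow (3)$. Moreover, if $t\text{-}\dim(R)=1$, then $(3) \Longrightarrow (1)$.
   Context: All rings are integral domains (commutative with $1$). Let $R$ be a domain with quotient field $F=\mathrm{qf}(R)$. For nonzero $R$-submodules $A,B$ of $F$, $(A:B):=\{x\in F : xB\subseteq A\}$. For a nonzero fractional ideal $I$ of $R$: $I^{-1}:=(R:I)$, $I_v:=(I^{-1})^{-1}$, and $I_t:=\bigcup J_v$, where $J$ ranges over the nonzero finitely generated fractional subideals of $I$. $I$ is a $t$-ideal if $I=I_t$ ($t$-ideals are nonzero fractional ideals). The $t$-class semigroup $\mathcal{S}_t(R)$ is the commutative semigroup of fractional $t$-ideals of $R$ under the $t$-multiplication $(I,J)\mapsto (IJ)_t$, modulo its subsemigroup of nonzero principal fractional ideals; i.e. $t$-ideals $I,J$ have the same class iff $J=cI$ for some $0\neq c\in F$. A commutative semigroup $S$ is Clifford if for every $x\in S$ there is $a\in S$ with $x=ax^2$. $R$ is Clifford $t$-regular if $\mathcal{S}_t(R)$ is a Clifford semigroup. For a $t$-ideal $I$ of $R$, $B:=(I:I)$ is an overring of $R$ with quotient field $F$ and $I$ is a fractional ideal of $B$; $I$ is $t$-invertible in $(I:I)$ if $(I(B:I))_{t_1}=B$, where $t_1$ denotes the $t$-operation with respect to the domain $B$. A nonzero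 ideal $I$ is $L$-stable if $\bigcup_{n\geq 1}(I^n:I^n)=(I:I)$. A $t$-prime ideal is a nonzero prime ideal of $R$ that is a $t$-ideal. The $t$-dimension $t\text{-}\dim(R)$ is the length of the longest chain of $t$-prime ideals of $R$, where $(0)$ is included as the bottom of the chain: a chain $(0)\subsetneq P_1\subsetneq\cdots\subsetneq P_n$ with each $P_i$ a $t$-prime has length $n$. *)

(* Defs.v *)
From HB Require Import structures.
From mathcomp Require Import all_boot all_algebra.
From mathcomp Require Import boolp classical_sets.

Set Implicit Arguments.
Unset Strict Implicit.
Unset Printing Implicit Defensive.

Import GRing.Theory.
Local Open Scope classical_set_scope.
Local Open Scope ring_scope.

Section IdealsOfARing.
Variable R : comNzRingType.
Implicit Types I P : set R.

Definition ideal I : Prop :=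
  [/\ I 0, forall x y, I x -> I y -> I (x + y)
         & forall a x, I x -> I (a * x)].

Definition prime_ideal P : Prop :=
  [/\ ideal P, ~ P 1 & forall a b, P (a * b) -> P a \/ P b].

Definition noetherian : Prop :=
  forall I, ideal I ->
    exists s : seq R,
      I = [set x | exists c : nat -> R, x = \sum_(i < size s) c i * s`_i].

End IdealsOfARing.

(* A domain with quotient field contained in F is represented by its carrier  *)
(* D : set F, so that the notions below apply both to R itself, seen inside   *)
(* its quotient field, and to overrings such as (I : I).                      *)
Section FractionalIdeals.
Variable F : fieldType.
Implicit Types (D A B I J : set F) (s : seq F).

Definition subring_set D : Prop :=
  [/\ D 1, forall x y, D x -> D y -> D (x - y)
         & forall x y, D x -> D y -> D (x * y)].

Definition submodule D A : Prop :=
  [/\ A 0, forall x y, A x -> A y -> A (x + y)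
         & forall a x, D a -> A x -> A (a * x)].

(* nonzero fractional ideals *)
Definition frac_ideal D A : Prop :=
  [/\ submodule D A, exists2 x, x != 0 & A x
    & exists2 d, d != 0 & D d /\ forall x, A x -> D (d * x)].

Definition span D s : set F :=
  [set x | exists2 c : nat -> F, forall i, D (c i)
         & x = \sum_(i < size s) c i * s`_i].

Definition fin_gen D A : Prop := exists s, A = span D s.

Definition colon A B : set F := [set x | forall y, B y -> A (x * y)].

Definition inv_ideal D I : set F := colon D I.

Definition v_closure D I : set F := inv_ideal D (inv_ideal D I).

Definition t_closure D I : set F :=
  [set x | exists J, [/\ frac_ideal D J, fin_gen D J, J `<=` I
                       & v_closure D J x]].

Definition t_ideal D I : Prop := frac_ideal D I /\ t_closure D I = I.

Definition prod_ideal A B : set F :=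
  [set x | exists2 s : seq (F * F), forall p, p \in s -> A p.1 /\ B p.2
         & x = \sum_(p <- s) p.1 * p.2].

Definition scale_ideal (c : F) A : set F := [set c * x | x in A].

(* [pow_ideal A n] is A^(n+1), so that n : nat ranges over all exponents      *)
(* at least 1.                                                                *)
Fixpoint pow_ideal A (n : nat) : set F :=
  if n is m.+1 then prod_ideal (pow_ideal A m) A else A.

Definition L_stable I : Prop :=
  \bigcup_n colon (pow_ideal I n) (pow_ideal I n) = colon I I.

Definition t_invertible D I : Prop :=
  t_closure D (prod_ideal I (colon D I)) = D.

Definition t_invertible_in_endo I : Prop := t_invertible (colon I I) I.

Lemma subring_submodule D : subring_set D -> submodule D D.
Proof.
case=> D1 DB DM; have D0 : D 0 by rewrite -(subrr 1); apply: DB.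
split=> // x y Dx Dy; rewrite -[y]opprK; apply: (DB) => //.
by rewrite -sub0r; apply: DB.
Qed.

Lemma submodule_sum D A n (f : nat -> F) :
  submodule D A -> (forall i, (i < n)%N -> A (f i)) -> A (\sum_(i < n) f i).
Proof.
by case=> A0 AD _ Af; elim/big_ind: _ => // i _; apply: Af.
Qed.

Lemma sub_span D s : subring_set D -> forall x, x \in s -> span D s x.
Proof.
move=> rD x xs; have [D0 _ _] := subring_submodule rD; have [D1 _ _] := rD.
have xs' : (index x s < size s)%N by rewrite index_mem.
exists (fun i => if i == index x s then 1 else 0) => [i|]; first by case: eqP.
rewrite (bigD1 (Ordinal xs')) //= eqxx mul1r nth_index // big1 ?addr0 // => i.
by rewrite -val_eqE /= => /negPf->; rewrite mul0r.
Qed.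

Lemma span_submodule D s : subring_set D -> submodule D (span D s).
Proof.
move=> rD; have [D0 DD DM] := subring_submodule rD; split.
- by exists (fun=> 0) => //; rewrite big1 // => i _; rewrite mul0r.
- move=> _ _ [c Dc ->] [e De ->]; exists (fun i => c i + e i) => [i|].
    exact: DD.
  by rewrite -big_split; apply: eq_bigr => i _; rewrite mulrDl.
- move=> a _ Da [c Dc ->]; exists (fun i => a * c i) => [i|]; first exact: DM.
  by rewrite mulr_sumr; apply: eq_bigr => i _; rewrite mulrA.
Qed.

Lemma span_min D A s :
  submodule D A -> (forall x, x \in s -> A x) -> span D s `<=` A.
Proof.
move=> mA sA _ [c Dc ->].
apply: (@submodule_sum D A _ (fun i => c i * s`_i)) => // i lis.
by case: mA => _ _; apply=> //; apply/sA/mem_nth.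
Qed.

Lemma frac_ideal_sub D A I : submodule D A -> (exists2 x, x != 0 & A x) ->
  A `<=` I -> frac_ideal D I -> frac_ideal D A.
Proof.
move=> mA nA AI [_ _ [d d0 [Dd dI]]]; split=> //; exists d => //; split=> //.
by move=> x /AI/dI.
Qed.

Lemma inv_ideal_submodule D I :
  subring_set D -> submodule D (inv_ideal D I).
Proof.
move=> rD; have [D0 DD DM] := subring_submodule rD; split.
- by move=> y _; rewrite mul0r.
- by move=> x y Ix Iy z Iz; rewrite mulrDl; apply: DD; [apply: Ix|apply: Iy].
- by move=> a x Da Ix z Iz; rewrite -mulrA; apply: DM => //; apply: Ix.
Qed.

Lemma inv_ideal_frac D I :
  subring_set D -> frac_ideal D I -> frac_ideal D (inv_ideal D I).
Proof.
move=> rD [[I0 ID IM] [x x0 Ix] [d d0 [Dd dI]]]; split.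
- exact: inv_ideal_submodule.
- by exists d.
- exists (d * x); first by rewrite mulf_neq0.
  by split=> [|y Iy]; [apply: dI | rewrite mulrC; apply/Iy/IM].
Qed.

Lemma v_closure_frac D I :
  subring_set D -> frac_ideal D I -> frac_ideal D (v_closure D I).
Proof. by move=> rD fI; do 2!apply: inv_ideal_frac => //. Qed.

Lemma inv_ideal_anti D I J : I `<=` J -> inv_ideal D J `<=` inv_ideal D I.
Proof. by move=> IJ x Jx y /IJ/Jx. Qed.

Lemma sub_v_closure D I : I `<=` v_closure D I.
Proof. by move=> x Ix y Iy; rewrite mulrC; apply: Iy. Qed.

Lemma v_closure_min D I J : I `<=` v_closure D J ->
  v_closure D I `<=` v_closure D J.
Proof.
move=> IJ x Ix y Jy; apply: Ix => z Iz.
by rewrite mulrC; apply: (IJ _ Iz).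
Qed.

Lemma v_closure_mono D I J : I `<=` J -> v_closure D I `<=` v_closure D J.
Proof.
by move=> IJ; apply: v_closure_min => x /IJ; apply: sub_v_closure.
Qed.

Lemma t_closureP D I x : subring_set D -> frac_ideal D I ->
  t_closure D I x <->
  exists s, [/\ forall y, y \in s -> I y, exists2 y, y != 0 & y \in s
              & v_closure D (span D s) x].
Proof.
move=> rD fI; split.
- case=> J [[_ [y y0 Jy] _] [s EJ]]; move: Jy; rewrite {J}EJ => sy sI vx.
  exists s; split=> //.
    by move=> z zs; apply/sI/sub_span.
  case/boolP: (has (fun z => z != 0) s) => [/hasP[z zs z0]|]; first by exists z.
  move=> /hasPn s0; suff /eqP : y = 0 by rewrite (negPf y0).
  have m0 : submodule D [set 0].
    split=> // [_ _ -> ->|a _ _ ->]; first by rewrite addr0.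
    by rewrite mulr0.
  by apply: (span_min (s := s) m0) sy => z /s0; rewrite negbK => /eqP.
- case=> s [sI [y y0 ys] vx]; exists (span D s).
  have mI : submodule D I by case: fI.
  split=> //; last exact: span_min; last by exists s.
  apply: (frac_ideal_sub (I := I)) => //;
    [exact: span_submodule | | exact: span_min].
  by exists y => //; apply: sub_span.
Qed.

Lemma span_subseq D s1 s2 : subring_set D -> {subset s1 <= s2} ->
  span D s1 `<=` span D s2.
Proof.
move=> rD s12; apply: span_min; first exact: span_submodule.
by move=> x /s12; apply: sub_span.
Qed.

Lemma t_closure_mono D I J : I `<=` J -> t_closure D I `<=` t_closure D J.
Proof.
by move=> IJ x [A [fA gA AI vA]]; exists A; split=> // y /AI/IJ.
Qed.

Lemma t_closure_sub_v D I : t_closure D I `<=` v_closure D I.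
Proof. by move=> x [A [_ _ AI]]; apply: v_closure_mono. Qed.

Lemma sub_t_closure D I : subring_set D -> frac_ideal D I ->
  I `<=` t_closure D I.
Proof.
move=> rD fI x Ix; apply/t_closureP => //; have [_ [y y0 Iy] _] := fI.
exists [:: x; y]; split; last 1 first.
- by apply: sub_v_closure; apply: sub_span => //; rewrite mem_head.
- by move=> z; rewrite !inE => /orP[] /eqP->.
- by exists y => //; rewrite !inE eqxx orbT.
Qed.

Lemma t_closure_seq D I s : subring_set D -> frac_ideal D I ->
  (forall x, x \in s -> t_closure D I x) ->
  exists u, [/\ forall y, y \in u -> I y, exists2 y, y != 0 & y \in u
              & forall x, x \in s -> v_closure D (span D u) x].
Proof.
move=> rD fI; elim: s => [_|x s IHs tI].
  have [_ [y y0 Iy] _] := fI; exists [:: y]; split=> //.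
    by move=> z; rewrite inE => /eqP->.
  by exists y => //; rewrite mem_head.
have [z zs|u [uI [y y0 yu] su]] := IHs.
  by apply: tI; rewrite inE zs orbT.
have /t_closureP[//|//|w [wI _ wx]] := tI x (mem_head _ _).
exists (u ++ w); split.
- by move=> z; rewrite mem_cat => /orP[/uI|/wI].
- by exists y => //; rewrite mem_cat yu.
- move=> z; rewrite inE => /orP[/eqP->|/su]; last first.
    by apply: v_closure_mono; apply: span_subseq => // t; rewrite mem_cat => ->.
  move: wx; apply: v_closure_mono; apply: span_subseq => // t.
  by rewrite mem_cat => ->; rewrite orbT.
Qed.

Lemma t_closure_frac D I : subring_set D -> frac_ideal D I ->
  frac_ideal D (t_closure D I).
Proof.
move=> rD fI; have mv s := inv_ideal_submodule (inv_ideal D (span D s)) rD.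
have tmin s x : (forall y, y \in s -> t_closure D I y) ->
    (forall A, submodule D A -> (forall y, y \in s -> A y) -> A x) ->
    t_closure D I x.
  move=> sI Ax; have [u [uI nu su]] := t_closure_seq rD fI sI.
  by apply/t_closureP => //; exists u; split=> //; apply: (Ax _ (mv u)).
apply: (frac_ideal_sub (I := v_closure D I)).
- split.
  + by apply: (tmin [::]) => // A [].
  + move=> x y tx ty; apply: (tmin [:: x; y]) => [z|A [_ AD _] Axy].
      by rewrite !inE => /orP[] /eqP->.
    by apply: AD; apply: Axy; rewrite !inE eqxx ?orbT.
  + move=> a x Da tx; apply: (tmin [:: x]) => [z|A [_ _ AM] Ax].
      by rewrite inE => /eqP->.
    by apply: AM => //; apply/Ax/mem_head.
- by have [_ [x x0 Ix] _] := fI; exists x => //; apply: sub_t_closure.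
- exact: t_closure_sub_v.
- exact: v_closure_frac.
Qed.

Lemma t_closure_id D I : subring_set D -> frac_ideal D I ->
  t_closure D (t_closure D I) = t_closure D I.
Proof.
move=> rD fI; have ft := t_closure_frac rD fI.
apply/seteqP; split; last exact: sub_t_closure.
move=> x /t_closureP[]// s [sI _ vx].
have [u [uI nu su]] := t_closure_seq rD fI sI.
apply/t_closureP => //; exists u; split=> //; move: vx.
apply: v_closure_min; apply: span_min su; exact: inv_ideal_submodule.
Qed.

Lemma t_closure_ideal D I : subring_set D -> frac_ideal D I ->
  t_ideal D (t_closure D I).
Proof.
by move=> rD fI; split; [apply: t_closure_frac | apply: t_closure_id].
Qed.

Lemma mem_prod_ideal A B x y : A x -> B y -> prod_ideal A B (x * y).
Proof.
move=> Ax By; exists [:: (x, y)]; last by rewrite big_seq1.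
by move=> p; rewrite inE => /eqP->.
Qed.

Lemma prod_ideal0 A B : prod_ideal A B 0.
Proof. by exists [::] => //; rewrite big_nil. Qed.

Lemma prod_idealD A B x y :
  prod_ideal A B x -> prod_ideal A B y -> prod_ideal A B (x + y).
Proof.
move=> [s sI ->] [u uI ->]; exists (s ++ u); last by rewrite big_cat.
by move=> p; rewrite mem_cat => /orP[/sI|/uI].
Qed.

Lemma prod_ideal_min A B (M : set F) : M 0 ->
  (forall x y, M x -> M y -> M (x + y)) ->
  (forall x y, A x -> B y -> M (x * y)) -> prod_ideal A B `<=` M.
Proof.
move=> M0 MD AB _ [s sI ->]; rewrite big_seq.
by elim/big_ind: _ => // p /sI[]; apply: AB.
Qed.

Lemma prod_idealS A A' B B' : A `<=` A' -> B `<=` B' ->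
  prod_ideal A B `<=` prod_ideal A' B'.
Proof.
by move=> AA BB x [s sI ->]; exists s => // p /sI[/AA ? /BB ?].
Qed.

Lemma prod_idealC : commutative prod_ideal.
Proof.
suff sC A B : prod_ideal A B `<=` prod_ideal B A by move=> A B; apply/seteqP.
apply: prod_ideal_min; [exact: prod_ideal0 | exact: prod_idealD |].
by move=> x y Ax By; rewrite mulrC; apply: mem_prod_ideal.
Qed.

Lemma prod_idealA : associative prod_ideal.
Proof.
have sA A B C : prod_ideal A (prod_ideal B C) `<=` prod_ideal (prod_ideal A B) C.
  apply: prod_ideal_min; [exact: prod_ideal0 | exact: prod_idealD |].
  move=> x y Ax; move: y.
  apply: (prod_ideal_min (M := [set y | prod_ideal (prod_ideal A B) C (x * y)])).
  - by rewrite /= mulr0; apply: prod_ideal0.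
  - by move=> y z /=; rewrite mulrDr; apply: prod_idealD.
  - move=> y z By Cz /=; rewrite mulrA; do 2!apply: mem_prod_ideal => //.
move=> A B C; apply/seteqP; split; first exact: sA.
rewrite (prod_idealC (prod_ideal _ _)) (prod_idealC A B).
by rewrite (prod_idealC A (prod_ideal _ _)) (prod_idealC B C); apply: sA.
Qed.

Lemma prod_ideal_frac D A B : subring_set D ->
  frac_ideal D A -> frac_ideal D B -> frac_ideal D (prod_ideal A B).
Proof.
move=> rD; have [D0 DD DM] := subring_submodule rD.
move=> [[_ _ AM] [x x0 Ax] [d d0 [Dd dA]]] [_ [y y0 By] [e e0 [De eB]]]; split.
- split; [exact: prod_ideal0 | exact: prod_idealD |].
  move=> a z Da; apply: (prod_ideal_min (M := [set z | prod_ideal A B (a * z)])).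
  + by rewrite /= mulr0; apply: prod_ideal0.
  + by move=> u v /=; rewrite mulrDr; apply: prod_idealD.
  + by move=> u v Au Bv /=; rewrite mulrA; apply: mem_prod_ideal => //; apply: AM.
- by exists (x * y); [rewrite mulf_neq0 | apply: mem_prod_ideal].
- exists (d * e); first by rewrite mulf_neq0.
  split=> [|z]; first exact: DM.
  apply: (prod_ideal_min (M := [set z | D (d * e * z)])).
  + by rewrite /= mulr0.
  + by move=> u v /=; rewrite mulrDr; apply: DD.
  + by move=> u v Au Bv /=; rewrite mulrACA; apply: DM; [apply: dA | apply: eB].
Qed.

Definition t_prod D A B : set F := t_closure D (prod_ideal A B).

Lemma t_prodC D : commutative (t_prod D).
Proof. by move=> A B; rewrite /t_prod prod_idealC. Qed.

Lemma t_prod_ideal D A B : subring_set D ->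
  frac_ideal D A -> frac_ideal D B -> t_ideal D (t_prod D A B).
Proof.
by move=> rD fA fB; apply: t_closure_ideal => //; apply: prod_ideal_frac.
Qed.

Lemma t_prod_closure D A B : subring_set D ->
  frac_ideal D A -> frac_ideal D B ->
  t_prod D (t_closure D A) B = t_prod D A B.
Proof.
move=> rD fA fB; have fAB := prod_ideal_frac rD fA fB.
have [[t0 tD tM] _ _] := t_closure_frac rD fAB.
apply/seteqP; split; last first.
  by apply/t_closure_mono/prod_idealS => //; apply: sub_t_closure.
rewrite -[X in _ `<=` X]t_closure_id //; apply: t_closure_mono.
apply: prod_ideal_min => // x y /t_closureP[]// s [sA [z z0 zs] vx] By.
have [->|y0] := eqVneq y 0; first by rewrite mulr0.
apply/t_closureP => //; exists [seq w * y | w <- s]; split.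
- by move=> _ /mapP[w /sA Aw ->]; apply: mem_prod_ideal.
- by exists (z * y); [rewrite mulf_neq0 | apply/mapP; exists z].
- move=> u iu; rewrite -mulrA; apply: vx => w [c Dc ->].
  rewrite [y * u]mulrC -mulrA; apply: iu; exists c => //.
  rewrite size_map mulr_sumr; apply: eq_bigr => i _.
  by rewrite (nth_map 0) // mulrCA [y * _]mulrC.
Qed.

Lemma t_prodA D A B C : subring_set D ->
  frac_ideal D A -> frac_ideal D B -> frac_ideal D C ->
  t_prod D A (t_prod D B C) = t_prod D (t_prod D A B) C.
Proof.
have tE X Y Z : subring_set D ->
    frac_ideal D X -> frac_ideal D Y -> frac_ideal D Z ->
    t_prod D (t_prod D X Y) Z = t_closure D (prod_ideal (prod_ideal X Y) Z).
  by move=> rD fX fY fZ; apply: t_prod_closure => //; apply: prod_ideal_frac.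
move=> rD fA fB fC; rewrite [LHS]t_prodC !tE //.
by rewrite (prod_idealC _ A) prod_idealA.
Qed.

Lemma scale_ideal1 A : scale_ideal 1 A = A.
Proof.
apply/seteqP; split=> [_ [x Ax <-]|x Ax]; rewrite ?mul1r //.
by exists x; rewrite ?mul1r.
Qed.

Lemma scale_idealM c d A :
  scale_ideal c (scale_ideal d A) = scale_ideal (c * d) A.
Proof.
apply/seteqP; split=> [_ [_ [x Ax <-] <-]|_ [x Ax <-]].
  by exists x; rewrite ?mulrA.
by rewrite -mulrA; exists (d * x) => //; exists x.
Qed.

Lemma scale_prod_ideal c A B :
  prod_ideal (scale_ideal c A) B = scale_ideal c (prod_ideal A B).
Proof.
apply/seteqP; split.
  apply: prod_ideal_min.
  - by exists 0; [apply: prod_ideal0 | rewrite mulr0].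
  - move=> _ _ [x Ax <-] [y Ay <-]; rewrite -mulrDr.
    by exists (x + y) => //; apply: prod_idealD.
  - move=> _ y [x Ax <-] By; rewrite -mulrA.
    by exists (x * y) => //; apply: mem_prod_ideal.
move=> _ [x ABx <-]; move: x ABx.
apply: (prod_ideal_min (M := [set x | prod_ideal (scale_ideal c A) B (c * x)])).
- by rewrite /= mulr0; apply: prod_ideal0.
- by move=> u v /=; rewrite mulrDr; apply: prod_idealD.
- move=> u v Au Bv /=; rewrite mulrA; apply: mem_prod_ideal => //.
  by exists u.
Qed.

Lemma scale_t_closure_sub D c A : subring_set D -> c != 0 ->
  frac_ideal D A -> frac_ideal D (scale_ideal c A) ->
  scale_ideal c (t_closure D A) `<=` t_closure D (scale_ideal c A).
Proof.
move=> rD c0 fA fcA _ [x /t_closureP[]// s [sA [z z0 zs] vx] <-].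
apply/t_closureP => //.
exists [seq c * w | w <- s]; split.
- by move=> _ /mapP[w /sA Aw ->]; exists w.
- by exists (c * z); [rewrite mulf_neq0 | apply/mapP; exists z].
- move=> u iu; have -> : c * x * u = x * (u * c) by rewrite [RHS]mulrC [u * c]mulrC [LHS]mulrAC.
  apply: vx => w [e De ->]; rewrite -mulrA; apply: iu; exists e => //.
  rewrite size_map mulr_sumr; apply: eq_bigr => i _.
  by rewrite (nth_map 0) // mulrCA.
Qed.

Lemma scale_t_closure D c A : subring_set D -> c != 0 ->
  frac_ideal D A -> frac_ideal D (scale_ideal c A) ->
  t_closure D (scale_ideal c A) = scale_ideal c (t_closure D A).
Proof.
move=> rD c0 fA fcA; apply/seteqP; split; last exact: scale_t_closure_sub.
have cK B : scale_ideal c^-1 (scale_ideal c B) = B.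
  by rewrite scale_idealM mulVf // scale_ideal1.
move=> x tx; exists (c^-1 * x); last by rewrite mulrA divff ?mul1r.
rewrite -[A]cK; apply: scale_t_closure_sub => //; rewrite ?invr_eq0 ?cK //.
by exists x.
Qed.

End FractionalIdeals.

Section TClassSemigroup.
Local Open Scope quotient_scope.
Variable R : idomainType.

Local Notation F := {fraction R}.

Definition base_ring : set F := range (@FracField.tofrac R).

Lemma base_ring_subring : subring_set base_ring.
Proof.
split; first by exists 1; rewrite ?tofrac1.
  by move=> _ _ [x _ <-] [y _ <-]; exists (x - y); rewrite ?tofracB.
by move=> _ _ [x _ <-] [y _ <-]; exists (x * y); rewrite ?tofracM.
Qed.

Record tIdeal := TIdeal {
  tIdeal_set :> set F;
  tIdealP : t_ideal base_ring tIdeal_set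
}.

HB.instance Definition _ := gen_eqMixin tIdeal.
HB.instance Definition _ := gen_choiceMixin tIdeal.

Lemma tIdeal_inj (I J : tIdeal) : I = J :> set F -> I = J.
Proof.
case: I J => [I tI] [J tJ] /= IJ; case: _ / IJ tJ => tJ.
by rewrite (Prop_irrelevance tI tJ).
Qed.

Lemma tIdeal_frac (I : tIdeal) : frac_ideal base_ring I.
Proof. by case: (tIdealP I). Qed.

Definition tIdeal_mul (I J : tIdeal) : tIdeal :=
  TIdeal (t_prod_ideal base_ring_subring (tIdeal_frac I) (tIdeal_frac J)).

Lemma tIdeal_mulC : commutative tIdeal_mul.
Proof. by move=> I J; apply: tIdeal_inj; apply: t_prodC. Qed.

Lemma tIdeal_mulA : associative tIdeal_mul.
Proof.
move=> I J K; apply: tIdeal_inj; apply: t_prodA;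
  by [apply: base_ring_subring | apply: tIdeal_frac].
Qed.

Definition same_class (I J : tIdeal) : bool :=
  `[< exists2 c : F, c != 0 & J = scale_ideal c I :> set F >].

Lemma same_class_refl : reflexive same_class.
Proof.
by move=> I; apply/asboolP; exists 1; rewrite ?oner_eq0 ?scale_ideal1.
Qed.

Lemma same_class_symW I J : same_class I J -> same_class J I.
Proof.
move=> /asboolP[c c0 EJ]; apply/asboolP; exists c^-1; rewrite ?invr_eq0 //.
by rewrite EJ scale_idealM mulVf // scale_ideal1.
Qed.

Lemma same_class_sym : symmetric same_class.
Proof. by move=> I J; apply/idP/idP; apply: same_class_symW. Qed.

Lemma same_class_trans : transitive same_class.
Proof.
move=> J I K /asboolP[c c0 EJ] /asboolP[d d0 EK]; apply/asboolP.
by exists (d * c); rewrite ?mulf_neq0 // EK EJ scale_idealM.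
Qed.

Lemma same_class_mull K I J :
  same_class I J -> same_class (tIdeal_mul I K) (tIdeal_mul J K).
Proof.
move=> /asboolP[c c0 EJ]; apply/asboolP; exists c => //=.
have rR := base_ring_subring.
rewrite /t_prod EJ scale_prod_ideal scale_t_closure //.
  by apply: prod_ideal_frac => //; apply: tIdeal_frac.
rewrite -scale_prod_ideal -EJ.
by apply: prod_ideal_frac => //; apply: tIdeal_frac.
Qed.

Canonical same_class_equiv :=
  EquivRel same_class same_class_refl same_class_sym same_class_trans.

Definition tClass : Type := {eq_quot same_class}.

HB.instance Definition _ := Choice.on tClass.
HB.instance Definition _ := EqQuotient.on tClass.

Definition tClass_mul (x y : tClass) : tClass :=
  \pi_tClass (tIdeal_mul (repr x) (repr y)).

(* The product of classes does not depend on the representatives.             *)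
Lemma tClass_mul_pi I J :
  tClass_mul (\pi_tClass I) (\pi_tClass J) = \pi_tClass (tIdeal_mul I J).
Proof.
have rP K : same_class (repr (\pi_tClass K)) K.
  by have /eqmodP := reprK (\pi_tClass K).
rewrite /tClass_mul; apply/eqmodP.
apply: (same_class_trans (y := tIdeal_mul I (repr (\pi_tClass J)))).
  exact: same_class_mull.
by rewrite ![tIdeal_mul I _]tIdeal_mulC; apply: same_class_mull.
Qed.

Lemma tClass_mulC : commutative tClass_mul.
Proof. by move=> x y; rewrite /tClass_mul tIdeal_mulC. Qed.

Lemma tClass_mulA : associative tClass_mul.
Proof.
move=> x y z; rewrite -[x]reprK -[y]reprK -[z]reprK.
move: (repr x) (repr y) (repr z) => I J K.
by rewrite (tClass_mul_pi J K) (tClass_mul_pi I) (tClass_mul_pi I J)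
           (tClass_mul_pi _ K) tIdeal_mulA.
Qed.

HB.instance Definition _ := isSemigroup.Build tClass tClass_mulA.

End TClassSemigroup.

Arguments base_ring : clear implicits.

Definition clifford (S : semigroupType) : Prop :=
  (forall x y : S, x * y = y * x)%g /\
  forall x : S, exists a : S, x = (a * (x * x))%g.

Definition clifford_t_regular (R : idomainType) : Prop := clifford (tClass R).

Section TDimension.
Variable R : idomainType.

Definition t_prime (P : set R) : Prop :=
  [/\ prime_ideal P, exists2 x, x != 0 & P x
    & t_ideal (base_ring R) (@FracField.tofrac R @` P)].

Definition t_prime_chain (n : nat) (P : nat -> set R) : Prop :=
  [/\ P 0%N = [set 0],
      forall i, (0 < i <= n)%N -> t_prime (P i)
    & forall i, (i < n)%N -> P i `<` P i.+1].

Definition t_dim_eq (n : nat) : Prop :=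
  (exists P, t_prime_chain n P) /\
  forall m P, t_prime_chain m P -> (m <= n)%N.

End TDimension.

(* Main.v *)
Require Import Defs.
From mathcomp Require Import all_boot all_algebra.
From mathcomp Require Import boolp classical_sets.

(* Put B = (I : I), J = I(B : I). Over a Noetherian domain t = v, so I is      *)
(* t-invertible in B iff (B : J) = B, and [I] is regular iff I = (IJ)_t.      *)
(*  (1) => (2): if x J is in B then x IJ is in I, hence x I = x (IJ)_t is     *)
(* in I.                                                                      *)
(*  (2) => (3): if x I^n is in I^n then x J^n is in B, and x is in B since    *)
(* (B : J) = B can be applied n times.                                        *)
(*  (3) => (1): if (IJ)_t <> I there is a t-prime P, of height one, containing *)
(* every r in R with r I in IJ; it suffices to find an element of J outside   *)
(* P. Let f be the polynomial whose coefficients generate I. In the           *)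
(* one-dimensional Noetherian local domain R_P a length count bounds the      *)
(* number of generators of submodules of F^d; applied to the powers of X in   *)
(* F[X]/(f) it gives g in F[X] such that fg has coefficients in R, one of     *)
(* them outside P. By the Dedekind-Mertens content formula and L-stability,   *)
(* the coefficients of g lie in (B : I), so those of fg lie in J.             *)

Set Implicit Arguments.
Unset Strict Implicit.
Unset Printing Implicit Defensive.

Import GRing.Theory Defs.

(** * Submodules of the quotient field and prime residuals *)

(** The three implications are [clifford_t_invertible], [t_invertible_endo_L_stable] and
    [L_stable_clifford]; the last is the deep one. If y in I is not in (IJ)_t, some z has z IJ
    inside D but yz outside D, so J yz lies in D. [prime_over_residual] enlarges (D : yz) to a prime
    P of the same form, a t-prime by [residual_ideal], and [L_stable_prod_prime_to] produces an
    element of J in D but outside P, a contradiction. That lemma combines [multiple_prime_to], where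
    lengths over D_P yield a multiple of f with a coefficient outside P, with [dedekind_mertens],
    which under L-stability puts the cofactor into (B : I). Dimension one enters through
    [t_prime_radical]: over D_P, each element of P is nilpotent modulo each nonzero a. *)

Section Submodules.
Variable F : fieldType.
Local Open Scope classical_set_scope.
Local Open Scope ring_scope.
Implicit Types (D A B C I P S X Y Z : set F) (s : seq F).

Lemma submoduleN D A x : subring_set D -> submodule D A -> A x -> A (- x).
Proof.
move=> rD [_ _ AM] Ax; have [D1 DB _] := rD; have [D0 _ _] := subring_submodule rD.
by rewrite -mulN1r; apply: AM => //; rewrite -sub0r; apply: DB.
Qed.

Lemma submoduleB D A x y : subring_set D -> submodule D A ->
  A x -> A y -> A (x - y).
Proof.
move=> rD mA Ax Ay; have [_ AD _] := mA.
by apply: AD => //; apply: (submoduleN rD mA).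
Qed.

Lemma submoduleI D A B : submodule D A -> submodule D B -> submodule D (A `&` B).
Proof.
move=> [A0 AD AM] [B0 BD BM]; split=> [|x y [? ?] [? ?]|a x Da [? ?]].
- by split.
- by split; [apply: AD | apply: BD].
- by split; [apply: AM | apply: BM].
Qed.

Definition sum_ideal A B : set F := [set x | exists2 a, A a & exists2 b, B b & x = a + b].

Lemma submodule_sum_ideal D A B :
  submodule D A -> submodule D B -> submodule D (sum_ideal A B).
Proof.
move=> [A0 AD AM] [B0 BD BM]; split.
- by exists 0 => //; exists 0 => //; rewrite addr0.
- move=> _ _ [a Aa [b Bb ->]] [a' Aa' [b' Bb' ->]].
  by exists (a + a'); [apply: AD | exists (b + b'); [apply: BD | rewrite addrACA]].
- move=> c _ Dc [a Aa [b Bb ->]].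
  by exists (c * a); [apply: AM | exists (c * b); [apply: BM | rewrite mulrDr]].
Qed.

Lemma submodule_scale D A c : submodule D A -> submodule D (scale_ideal c A).
Proof.
move=> [A0 AD AM]; split.
- by exists 0; rewrite ?mulr0.
- by move=> _ _ [x Ax <-] [y Ay <-]; exists (x + y); [apply: AD | rewrite mulrDr].
- by move=> a _ Da [x Ax <-]; exists (a * x); [apply: AM | rewrite mulrCA].
Qed.

Lemma submodule_prod D A B : submodule D A -> submodule D (prod_ideal A B).
Proof.
move=> [_ _ AM]; split; [exact: prod_ideal0 | exact: prod_idealD |].
move=> a x Da; apply: (prod_ideal_min (M := [set z | prod_ideal A B (a * z)])).
- by rewrite /= mulr0; apply: prod_ideal0.
- by move=> u v /=; rewrite mulrDr; apply: prod_idealD.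
- by move=> u v Au Bv /=; rewrite mulrA; apply: mem_prod_ideal => //; apply: AM.
Qed.

Lemma submodule_pow D A n : submodule D A -> submodule D (pow_ideal A n).
Proof. by move=> mA; elim: n => //= n IHn; apply: submodule_prod. Qed.

Lemma submodule_colon D A B :
  submodule D A -> submodule D (colon A B).
Proof.
move=> [A0 AD AM]; split.
- by move=> y _; rewrite mul0r.
- by move=> x y Ax Ay z Bz; rewrite mulrDl; apply: AD; [apply: Ax | apply: Ay].
- by move=> a x Da Ax z Bz; rewrite -mulrA; apply: AM => //; apply: Ax.
Qed.

Lemma colon_frac D A B : subring_set D -> frac_ideal D A -> frac_ideal D B ->
  frac_ideal D (colon A B).
Proof.
move=> rD [mA [a a0 Aa] [d d0 [Dd dA]]] [[_ _ BM] [b b0 Bb] [e e0 [De eB]]].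
have [_ _ AM] := mA; split; first exact: submodule_colon.
  exists (e * a) => [|y By]; first by rewrite mulf_neq0.
  by rewrite mulrAC; apply: AM => //; apply: eB.
exists (d * (e * b)); first by rewrite !mulf_neq0.
have [_ _ DM] := rD; split; first by apply: DM => //; apply: eB.
move=> x Cx; rewrite -mulrA; apply: dA; rewrite -mulrA; apply: AM => //.
by rewrite mulrC; apply: Cx.
Qed.

Lemma colon_subring D I : submodule D I -> subring_set D -> subring_set (colon I I).
Proof.
move=> mI rD; split.
- by move=> y; rewrite mul1r.
- move=> x y Ix Iy z Iz; rewrite mulrBl.
  by apply: (submoduleB rD mI); [apply: Ix | apply: Iy].
- by move=> x y Ix Iy z Iz; rewrite -mulrA; apply/Ix/Iy.
Qed.

Lemma sub_colon D I : submodule D I -> D `<=` colon I I.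
Proof. by move=> [_ _ IM] x Dx y; apply: IM. Qed.

Lemma colon_colon_frac D I : subring_set D -> frac_ideal D I ->
  frac_ideal D (colon (colon I I) I).
Proof. by move=> rD fI; apply: colon_frac => //; apply: colon_frac. Qed.

Definition noetherian_set D : Prop :=
  forall A, submodule D A -> A `<=` D -> fin_gen D A.

(** Without a maximal member, dependent choice gives a strictly increasing sequence in [E]; the
    generators of its union all lie in one term, where the sequence must stop. *)
Lemma noetherian_max D (E : set (set F)) : subring_set D -> noetherian_set D ->
  (forall A, E A -> submodule D A /\ A `<=` D) -> (exists A, E A) ->
  exists2 A, E A & forall B, E B -> A `<=` B -> B `<=` A.
Proof.
move=> rD nD ED [A0 EA0]; apply: contrapT => noMax.
have next (A : {A | E A}) : {B : {A | E A} | sval A `<=` sval B /\ ~ (sval B `<=` sval A)}.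
  apply: cid; case: A => A EA /=; apply: contrapT => nB; apply: noMax.
  exists A => // B EB AB; apply: contrapT => nBA; apply: nB.
  by exists (exist _ B EB).
have [f [_ fP]] := dependent_choice next (exist _ A0 EA0).
pose U := \bigcup_n sval (f n).
have mono i j : (i <= j)%N -> sval (f i) `<=` sval (f j).
  move=> /subnK <-; elim: (j - i)%N => [|k IHk] //; rewrite addSn.
  by move=> x /IHk; case: (fP (k + i)%N) => + _; apply.
have fE n : submodule D (sval (f n)) /\ sval (f n) `<=` D by apply: ED; case: (f n).
have mU : submodule D U.
  split.
  - by exists 0%N => //; case: (fE 0%N) => [[]].
  - move=> x y [i _ fx] [j _ fy]; exists (maxn i j) => //.
    have [[_ fD _] _] := fE (maxn i j).
    by apply: fD; [apply: mono fx; apply: leq_maxl | apply: mono fy; apply: leq_maxr].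
  - by move=> a x Da [i _ fx]; exists i => //; have [[_ _ fM] _] := fE i; apply: fM.
have UD : U `<=` D by move=> x [i _]; case: (fE i) => _; apply.
have [s Us] := nD _ mU UD.
have [n sn] : exists n, forall x, x \in s -> sval (f n) x.
  have: forall x, x \in s -> U x.
    by move=> x xs; rewrite Us; apply: sub_span.
  elim: s {Us} => [|x s IHs] sU; first by exists 0%N.
  have [|n nP] := IHs; first by move=> y ys; apply: sU; rewrite inE ys orbT.
  have [i _ fx] := sU x (mem_head _ _); exists (maxn i n) => y.
  rewrite inE => /orP[/eqP->|/nP]; first exact: mono (leq_maxl _ _) _ _.
  exact: mono (leq_maxr _ _) _.
have [mn _] := fE n; have [_] := fP n; apply => x fx.
suff: U x by rewrite Us; apply: (span_min mn sn).
by exists n.+1.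
Qed.

Lemma noetherian_frac_fin_gen D A : subring_set D -> noetherian_set D ->
  frac_ideal D A -> fin_gen D A.
Proof.
move=> rD nD [mA _ [d d0 [Dd dA]]].
have [|s Es] := nD _ (submodule_scale d mA).
  by move=> _ [x Ax <-]; apply: dA.
have sA x : x \in s -> A (d^-1 * x).
  move=> /(sub_span rD); rewrite -Es => -[y Ay <-].
  by rewrite mulrA mulVf // mul1r.
exists [seq d^-1 * x | x <- s]; apply/seteqP; split; last first.
  by apply: span_min => // _ /mapP[x /sA ? ->].
move=> x Ax; have : scale_ideal d A (d * x) by exists x.
rewrite Es => -[c Dc Ex]; exists c => //; apply: (mulfI d0); rewrite Ex.
rewrite size_map mulr_sumr; apply: eq_bigr => i _.
by rewrite (nth_map 0) // mulrCA mulVKf.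
Qed.

Definition prime_set D P : Prop :=
  [/\ submodule D P, P `<=` D, ~ P 1
    & forall a b, D a -> D b -> P (a * b) -> P a \/ P b].

Definition residual D A y : set F := [set r | D r /\ A (r * y)].

Lemma residual_submodule D A y : subring_set D -> submodule D A ->
  submodule D (residual D A y).
Proof.
move=> rD [A0 AD AM]; have [D0 DD DM] := subring_submodule rD; split.
- by split=> //; rewrite mul0r.
- by move=> a b [Da Aa] [Db Ab]; split; [apply: DD | rewrite mulrDl; apply: AD].
- by move=> c a Dc [Da Aa]; split; [apply: DM | rewrite -mulrA; apply: AM].
Qed.

(* A residual (A : y) maximal among those disjoint from a multiplicative set  *)
(* is prime; unlike a maximal disjoint ideal, it is divisorial when A is.     *)
Lemma prime_residual D A S : subring_set D -> noetherian_set D ->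
  submodule D A -> S `<=` D -> S 1 -> (forall a b, S a -> S b -> S (a * b)) ->
  (forall x, S x -> ~ A x) ->
  exists y, [/\ D y, prime_set D (residual D A y)
              & forall x, S x -> ~ residual D A y x].
Proof.
move=> rD nD mA SD S1 SM SA; have [D1 _ DM] := rD; have [A0 AD AM] := mA.
pose E := [set Q | exists2 y, D y & Q = residual D A y /\ forall x, S x -> ~ Q x].
have [||_ [y Dy [-> Sy]] ymax] := @noetherian_max D E rD nD.
- move=> _ [y Dy [-> _]]; split; first exact: residual_submodule.
  by move=> x [].
- exists (residual D A 1); exists 1 => //; split=> // x Sx [_].
  by rewrite mulr1; apply: SA.
have big v : D v -> (forall x, S x -> ~ residual D A (v * y) x) ->
    residual D A (v * y) `<=` residual D A y.
  move=> Dv Sv; apply: ymax.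
    by exists (v * y) => //; apply: DM.
  by move=> r [Dr Ar]; split=> //; rewrite mulrCA; apply: AM.
exists y; split=> //; split; first exact: residual_submodule.
- by move=> x [].
- exact: Sy.
move=> u v Du Dv [_ Auv]; have [Sv|] := pselect (forall x, S x -> ~ residual D A (v * y) x).
  by left; apply: big Sv _ _ => //; split=> //; rewrite mulrA.
move=> /existsNP[s /not_implyP[Ss /contrapT[Ds Asv]]]; right.
apply: (big s) => //; last by split=> //; rewrite mulrCA.
move=> t St [Dt]; rewrite mulrA => Ats; apply: (Sy _ (SM _ _ St Ss)).
by split=> //; apply: DM.
Qed.

Definition has_denominators D : Prop := forall x, exists2 d, d != 0 & D d /\ D (d * x).

(** This ideal is the inverse of D + Dw, hence divisorial, and therefore a t-ideal. *)
Lemma residual_ideal D w : subring_set D -> has_denominators D ->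
  t_ideal D (residual D D w).
Proof.
move=> rD qD; have [D1 _ _] := rD; have mD := subring_submodule rD.
have mP := residual_submodule w rD mD.
have fP : frac_ideal D (residual D D w).
  split=> //; first by have [d d0 dw] := qD w; exists d.
  by exists 1; rewrite ?oner_eq0 //; split=> // x [Dx _]; rewrite mul1r.
split=> //; apply/seteqP; split; last exact: sub_t_closure.
move=> x /t_closure_sub_v vx; split.
  by rewrite -[x]mulr1; apply: vx => y [Dy _]; rewrite mul1r.
by apply: vx => y [_ Dy]; rewrite mulrC.
Qed.

Lemma residual_scale D a y : a != 0 ->
  residual D (scale_ideal a D) y = residual D D (y / a).
Proof.
move=> a0; apply/seteqP; split=> r [Dr]; last first.
  by move=> Dry; split=> //; exists (r * (y / a)) => //; rewrite mulrCA [y / a]mulrC mulVKf.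
by move=> [z Dz Ez]; split=> //; rewrite mulrA -Ez mulrAC divff ?mul1r.
Qed.

(** Take (D : w) maximal among the proper residuals containing (D : y). If uv lies in it and v does
    not, then (D : vw) is proper and contains (D : w), so it equals (D : w), and it contains u. *)
Lemma prime_over_residual D y : subring_set D -> noetherian_set D -> ~ D y ->
  exists w, prime_set D (residual D D w) /\ residual D D y `<=` residual D D w.
Proof.
move=> rD nD nDy; have [D1 _ DM] := rD; have mD := subring_submodule rD.
pose E := [set Q | exists2 w, ~ D w & Q = residual D D w /\ residual D D y `<=` Q].
have [||_ [w nDw [-> yw]] wmax] := @noetherian_max D E rD nD.
- move=> _ [w _ [-> _]]; split; first exact: residual_submodule.
  by move=> x [].
- by exists (residual D D y); exists y => //; split.
exists w; split=> //; split; first exact: residual_submodule.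
- by move=> x [].
- by move=> [_]; rewrite mul1r.
move=> u v Du Dv [_ Duv]; have [Dvw|nDvw] := pselect (D (v * w)).
  by right.
left; apply: (wmax (residual D D (v * w))); last by split=> //; rewrite mulrA.
  exists (v * w) => //; split=> // r /yw[Dr Drw]; split=> //.
  by rewrite mulrCA; apply: DM.
by move=> r [Dr Drw]; split=> //; rewrite mulrCA; apply: DM.
Qed.

Lemma prime_power D P x n : subring_set D -> prime_set D P -> D x -> P (x ^+ n) -> P x.
Proof.
move=> rD [_ _ P1 PM] Dx; have [D1 _ DM] := rD.
have Dxn m : D (x ^+ m) by elim: m => // m IHm; rewrite exprS; apply: DM.
by elim: n => [/P1//|n IHn]; rewrite exprS => /PM[].
Qed.

(** This says that the t-dimension is at most one; [t_ideal] already forces P and Q to be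
    nonzero. *)
Definition t_dim_one D : Prop := forall P Q, prime_set D P -> prime_set D Q ->
  t_ideal D P -> t_ideal D Q -> Q `<=` P -> P `<=` Q.

(** Otherwise aD misses the multiplicative set of all u x^n with u in D outside P. A prime residual
    of aD that misses it too is a t-prime inside P without x, against dimension one. *)
Lemma t_prime_radical D P a x : subring_set D -> noetherian_set D ->
  has_denominators D -> t_dim_one D -> prime_set D P -> t_ideal D P ->
  D a -> a != 0 -> P x ->
  exists n u, [/\ D u, ~ P u & scale_ideal a D (u * x ^+ n)].
Proof.
move=> rD nD qD dD pP tP Da a0 Px; have [mP PD P1 PM] := pP; have [D1 _ DM] := rD.
apply: contrapT => nex; have Dxn m : D (x ^+ m).
  by elim: m => // m IHm; rewrite exprS; apply: DM => //; apply: PD.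
pose S := [set t | exists n u, [/\ D u, ~ P u & t = u * x ^+ n]].
have [|||||y [Dy pQ SQ]] := @prime_residual D (scale_ideal a D) S rD nD.
- by apply: submodule_scale; apply: subring_submodule.
- by move=> _ [n [s [Ds _ ->]]]; apply: DM.
- by exists 0%N, 1; rewrite mulr1.
- move=> _ _ [n [s [Ds Ps ->]]] [m [t [Dt Pt ->]]].
  exists (n + m)%N, (s * t); rewrite mulrACA exprD; split=> //; first exact: DM.
  by move=> /PM[].
- by move=> _ [n [s [Ds Ps ->]]] ax; apply: nex; exists n, s.
(* Written as (D : y/a), the prime residual is a t-ideal by [residual_ideal]. *)
move: pQ SQ; rewrite residual_scale //; set Q := residual D D _ => pQ SQ.
have QP : Q `<=` P.
  move=> r Qr; apply: contrapT => Pr; apply: SQ (Qr); exists 0%N, r.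
  by rewrite mulr1; split=> //; case: Qr.
have Qx := dD _ _ pP pQ tP (residual_ideal _ rD qD) QP _ Px.
by apply: SQ Qx; exists 1%N, 1; rewrite mul1r.
Qed.

End Submodules.

(** * Lengths and numbers of generators over a one-dimensional local domain *)

Section ChainLength.
Variable F : fieldType.
Local Open Scope classical_set_scope.
Local Open Scope ring_scope.
Implicit Types (A B X Y Z M : set F).

(* Only the intermediate terms are required to be L-submodules, not the ends  *)
(* Y and X.                                                                   *)
Inductive chain (L Y : set F) : set F -> nat -> Prop :=
| chain_refl X : Y `<=` X -> chain L Y X 0
| chain_step Z X k : submodule L Z -> chain L Y Z k -> Z `<=` X -> ~ X `<=` Z ->
    chain L Y X k.+1.

Definition length_le (L Y X : set F) (e : nat) : Prop :=
  forall k, chain L Y X k -> (k <= e)%N.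

Variable L : set F.
Hypothesis rL : subring_set L.

Lemma chain_sub Y X k : chain L Y X k -> Y `<=` X.
Proof. by elim=> // Z W j _ _ YZ ZW _ x /YZ/ZW. Qed.

Lemma chain_le0 Y X k : chain L Y X k -> X `<=` Y -> k = 0%N.
Proof.
case=> // Z W j _ YZ ZW nWZ WY; case: nWZ => x /WY; exact: chain_sub YZ _.
Qed.

Lemma chain_weakr Y X X' k : chain L Y X k -> X `<=` X' -> chain L Y X' k.
Proof.
case=> [Z YZ ZX'|Z W j mZ YZ ZW nWZ WX'].
  by apply: chain_refl => x /YZ/ZX'.
apply: chain_step mZ YZ _ _ => [x /ZW/WX'//|X'Z].
by apply: nWZ => x /WX'/X'Z.
Qed.

Lemma chain_weakl Y Y' X k : chain L Y X k -> Y' `<=` Y -> chain L Y' X k.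
Proof.
elim=> [Z YZ Y'Y|Z W j mZ _ IH ZW nWZ Y'Y].
  by apply: chain_refl => x /Y'Y/YZ.
exact: chain_step mZ (IH Y'Y) ZW nWZ.
Qed.

Lemma chain_cat Z Y X j k : chain L Z Y j -> chain L Y X k -> chain L Z X (k + j).
Proof.
move=> ZY; elim=> [W YW|V W i mV _ IH VW nWV]; first exact: chain_weakr ZY YW.
by rewrite addSn; apply: chain_step mV IH VW nWV.
Qed.

Lemma chain_scale c Y X k : c != 0 -> chain L Y X k ->
  chain L (scale_ideal c Y) (scale_ideal c X) k.
Proof.
move=> c0; elim=> [Z YZ|Z W i mZ _ IH ZW nWZ].
  by apply: chain_refl => _ [x /YZ Zx <-]; exists x.
apply: chain_step IH _ _; first exact: submodule_scale.
  by move=> _ [x /ZW Wx <-]; exists x.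
move=> cWZ; apply: nWZ => x Wx.
by have [|y Zy /(mulfI c0) <-] := cWZ (c * x); first by exists x.
Qed.

Lemma length_le_scale c Y X e : c != 0 -> length_le L Y X e ->
  length_le L (scale_ideal c Y) (scale_ideal c X) e.
Proof.
move=> c0 le_e k /(@chain_scale c^-1); rewrite invr_eq0 !scale_idealM mulVf //.
by rewrite !scale_ideal1 => /(_ c0)/le_e.
Qed.

(** Intersect a chain with Y and also add Y to it. By the modular law each strict inclusion stays
    strict in at least one of the two resulting chains. *)
Lemma length_le_cat Z Y X e e' : submodule L Z -> submodule L Y -> submodule L X ->
  length_le L Z Y e -> length_le L Y X e' -> Z `<=` Y -> Y `<=` X ->
  length_le L Z X (e + e').
Proof.
move=> mZ mY mX le_e le_e' ZY YX k0 ch0.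
suff split W k : chain L Z W k -> submodule L W -> exists i j, [/\ (k <= i + j)%N,
    chain L Z (W `&` Y) i & chain L Y (sum_ideal W Y) j].
  have [i [j [ij Zi Yj]]] := split _ _ ch0 mX; apply: leq_trans ij _; apply: leq_add.
    by apply/le_e/(chain_weakr Zi) => x [].
  apply/le_e'/(chain_weakr Yj) => _ [x Xx [y /YX Xy ->]].
  by have [_ XD _] := mX; apply: XD.
elim=> {W k} [W ZW|V W k mV _ IH VW nWV] mW.
  exists 0%N, 0%N; split=> //; apply: chain_refl => x; first by split; [apply: ZW | apply: ZY].
  by exists 0; [case: mW | exists x; rewrite ?add0r].
have [i [j [kij ZVi YVj]]] := IH mV.
have VWY : V `&` Y `<=` W `&` Y by move=> x [/VW].
have VWsY : sum_ideal V Y `<=` sum_ideal W Y.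
  by move=> _ [x /VW Wx [y Yy ->]]; exists x => //; exists y.
have [WVY|nWVY] := pselect (W `&` Y `<=` V `&` Y); last first.
  exists i.+1, j; split=> //; last exact: chain_weakr YVj _.
  exact: chain_step (submoduleI mV mY) ZVi VWY nWVY.
exists i, j.+1; split; [by rewrite addnS | exact: chain_weakr ZVi _ |].
apply: chain_step (submodule_sum_ideal mV mY) YVj VWsY _ => sWV; apply: nWV => x Wx.
have [|v Vv [y Yy Ex]] := sWV x.
  by exists x => //; exists 0; [case: mY | rewrite addr0].
have [|Vy _] := WVY y; last by rewrite Ex; have [_ VD _] := mV; apply: VD.
have -> : y = x - v by rewrite Ex addrC addKr.
split; last by rewrite Ex addrC addKr.
by apply: (submoduleB rL mW) => //; apply: VW.
Qed.

Variable M : set F.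
Hypotheses (mM : submodule L M) (M1 : ~ M 1).
Hypothesis invM : forall x, L x -> ~ M x -> L x^-1.

(** The quotient (A + Ly)/A is killed by M and cyclic, so it is at most a line over the residue
    field L/M. *)
Lemma length_le_simple A y : submodule L A -> (forall x, M x -> A (x * y)) ->
  length_le L A (sum_ideal A (scale_ideal y L)) 1.
Proof.
move=> mA My k; have [_ _ LM] := rL; have [_ _ AM] := mA.
move EX: (sum_ideal _ _) => X ch; case: ch EX => [//|Z {}X j mZ AZ ZX nXZ] EX.
have [_ ZD ZM] := mZ; have AsubZ := chain_sub AZ.
suff ZA : Z `<=` A by rewrite (chain_le0 AZ ZA).
move=> z Zz; apply: contrapT => nAz; apply: nXZ.
have := ZX _ Zz; rewrite -EX => -[a Aa [_ [c Lc <-] Ez]].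
have [Mc|nMc] := pselect (M c).
  by case: nAz; rewrite Ez mulrC; case: mA => _ AD _; apply: AD => //; apply: My.
have Zy : Z y.
  have c0 : c != 0 by apply/eqP => c0; apply: nMc; rewrite c0; case: mM.
  have -> : y = c^-1 * (z - a) by rewrite Ez addrC addKr mulrCA mulVf ?mulr1.
  by apply: ZM; [exact: invM | apply: (submoduleB rL mZ) => //; apply: AsubZ].
move=> _ [u Au [_ [v Lv <-] ->]]; apply: ZD; first exact: AsubZ.
by rewrite mulrC; apply: ZM.
Qed.

Hypothesis nL : noetherian_set L.
Hypothesis dimL : forall b x, L b -> b != 0 -> M x ->
  exists n, scale_ideal b L (x ^+ n).
Hypothesis ML : M `<=` L.

(** Let A be maximal among the ideals of finite length over bL. If A is proper, it has a prime
    residual (A : y); this contains M, as each element of M has a power in bL. So A + Ly is longer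
    than A by at most one, maximality gives y in A, and (A : y) is not proper. *)
Lemma length_finite b : L b -> b != 0 -> exists e, length_le L (scale_ideal b L) L e.
Proof.
move=> Lb b0; have [L1 _ LM] := rL; have mL := subring_submodule rL.
have mbL := submodule_scale b mL.
pose E := [set A | [/\ submodule L A, A `<=` L, scale_ideal b L `<=` A
                     & exists e, length_le L (scale_ideal b L) A e]].
have [||A [mA AL bA [e Ae]] Amax] := @noetherian_max F L E rL nL.
- by move=> A [].
- exists (scale_ideal b L); split=> //; first by move=> _ [x Lx <-]; apply: LM.
  by exists 0%N => k /chain_le0->.
have [_ AD AM] := mA; have [A1|nA1] := pselect (A 1).
  exists e => k /chain_weakr ch; apply/Ae/ch => x Lx.
  by rewrite -[x]mulr1; apply: AM.
have [||||y [Ly pQ _]] := @prime_residual F L A [set 1] rL nL mA.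
- by move=> _ ->.
- by [].
- by move=> _ _ -> ->; rewrite mulr1.
- by move=> _ ->.
have [_ _ nQ1 _] := pQ.
have My x : M x -> A (x * y).
  move=> Mx; have [n xn] := dimL Lb b0 Mx; have Lx := ML Mx.
  have [|_ //] := @prime_power F L (residual L A y) x n rL pQ Lx.
  split; first by case: xn => u Lu <-; apply: LM.
  by rewrite mulrC; apply: AM => //; apply: bA.
case: nQ1; split=> //; rewrite mul1r.
apply: (Amax (sum_ideal A (scale_ideal y L))).
- split.
  + exact: submodule_sum_ideal (submodule_scale y mL).
  + move=> _ [x Ax [_ [z Lz <-] ->]]; have [_ LD _] := mL.
    by apply: LD; [apply: AL | apply: LM].
  + move=> x /bA Ax; exists x => //; exists 0; rewrite ?addr0 //.
    by case: (submodule_scale y mL).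
  + exists (e + 1)%N; apply: (length_le_cat (Y := A)) => //.
    * exact: submodule_sum_ideal (submodule_scale y mL).
    * exact: length_le_simple.
    * by move=> x Ax; exists x => //; exists 0; rewrite ?addr0 //; case: (submodule_scale y mL).
- by move=> x Ax; exists x => //; exists 0; rewrite ?addr0 //; case: (submodule_scale y mL).
- exists 0; first by case: mA.
  by exists y; rewrite ?add0r //; exists 1; rewrite ?mulr1.
Qed.

Hypothesis M_neq0 : exists2 a, a != 0 & M a.
Hypothesis qL : has_denominators L.

Lemma common_denominator (T : finType) (v : T -> F) :
  exists2 d, d != 0 & L d /\ forall i, L (d * v i).
Proof.
have [_ _ LM] := rL; have [L1 _ _] := rL.
have [f fP] := @choice T F (fun i d => d != 0 /\ L d /\ L (d * v i))
  (fun i => let: ex_intro2 d d0 dP := qL (v i) in ex_intro _ d (conj d0 dP)).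
have Lprod (P : pred T) : L (\prod_(i | P i) f i).
  by elim/big_ind: _ => // i _; case: (fP i) => _ [].
exists (\prod_i f i); first by apply/prodf_neq0 => i _; case: (fP i).
split=> // i; rewrite (bigD1 i) //= [f i * _]mulrC -mulrA.
by apply: LM => //; case: (fP i) => _ [].
Qed.

(** Some coefficient is a unit of the local ring L, so one v_i is an L-combination of the others; by
    Nakayama, the absence of such a relation means that v generates its L-span minimally. *)
Definition unit_relation (V : lmodType F) (T : finType) (v : T -> V) : Prop :=
  exists c : T -> F, [/\ forall i, L (c i), exists i, ~ M (c i)
                       & \sum_i c i *: v i = 0].

Let L0 : L 0. Proof. by case: (subring_submodule rL). Qed.
Let M0 : M 0. Proof. by case: mM. Qed.
Let L1 : L 1. Proof. by case: rL. Qed.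
Let LM x y : L x -> L y -> L (x * y). Proof. by case: rL => _ _; apply. Qed.

Lemma indicator_relation m (w : 'I_m -> F) j :
  \sum_(i < m) (if i == j then 1 else 0) * w i = w j.
Proof.
rewrite (bigD1 j) //= eqxx mul1r big1 ?addr0 // => i /negPf->.
by rewrite mul0r.
Qed.

(** The terms W_j take coefficients in L before index j and in M from j on, so they climb from MV,
    which contains aV, to V. If W_{j+1} were inside W_j, then w_j would be a combination with its
    own coefficient in M, and subtracting would give a unit relation. *)
Lemma scalar_chain m (w : 'I_m -> F) a : M a ->
  ~ unit_relation (w : 'I_m -> F^o) ->
  let V := [set x | exists2 c : 'I_m -> F, forall i, L (c i) & x = \sum_i c i * w i] in
  chain L (scale_ideal a V) V m.
Proof.
move=> Ma nrel V.
pose W j := [set x | exists2 c : 'I_m -> F,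
  forall i, L (c i) /\ ((j <= i)%N -> M (c i)) & x = \sum_i c i * w i].
have mW j : submodule L (W j).
  have [_ LD _] := subring_submodule rL; have [_ MD MZ] := mM; split.
  - by exists (fun=> 0) => //; rewrite big1 // => i _; rewrite mul0r.
  - move=> _ _ [c cP ->] [e eP ->]; exists (fun i => c i + e i) => [i|].
      have [[Lc Mc] [Le Me]] := (cP i, eP i).
      by split=> [|ji]; [apply: LD | apply: MD; [apply: Mc | apply: Me]].
    by rewrite -big_split; apply: eq_bigr => i _; rewrite mulrDl.
  - move=> x _ Lx [c cP ->]; exists (fun i => x * c i) => [i|].
      by have [Lc Mc] := cP i; split=> [|/Mc]; [apply: LM | apply: MZ].
    by rewrite mulr_sumr; apply: eq_bigr => i _; rewrite mulrA.
suff chW j : (j <= m)%N -> chain L (scale_ideal a V) (W j) j.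
  apply: chain_weakr (chW m (leqnn m)) _ => _ [c cP ->].
  by exists c => // i; case: (cP i).
elim: j => [_|j IHj ltjm].
  apply: chain_refl => _ [_ [c Lc ->] <-]; exists (fun i => a * c i) => [i|].
    split=> [|_]; first by apply: LM => //; apply: ML.
    by rewrite mulrC; case: mM => _ _; apply.
  by rewrite mulr_sumr; apply: eq_bigr => i _; rewrite mulrA.
apply: chain_step (mW j) (IHj (ltnW ltjm)) _ _.
  move=> _ [c cP ->]; exists c => // i; have [Lc Mc] := cP i.
  by split=> // /ltnW.
move=> WW; pose jo := Ordinal ltjm; have [|c cP Ec] := WW (w jo).
  exists (fun i => if i == jo then 1 else 0) => [i|].
    by case: eqP => [->|_]; split=> //=; rewrite ltnn.
  by rewrite indicator_relation.
apply: nrel; exists (fun i => (if i == jo then 1 else 0) - c i); split.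
- move=> i; have [Lc _] := cP i; apply: (submoduleB rL (subring_submodule rL)) => //.
  by case: eqP.
- exists jo; rewrite eqxx => M1c; apply: M1; rewrite -[1](subrK (c jo)).
  by case: mM => _ MD _; apply: MD => //; case: (cP jo) => _; apply.
- rewrite -[RHS](subrr (w jo)) {2}Ec -{1}(indicator_relation w jo) -sumrB.
  by apply: eq_bigr => i _; rewrite /GRing.scale /= mulrBl.
Qed.

(* If v spans V without unit relation, then length(V / a^n V) >= n (e + 1),   *)
(* whereas length(L / a^n b L) <= n e + O(1); V lies between b L and L.       *)
Lemma scalar_relation : exists m, forall v : 'I_m -> F, unit_relation (v : 'I_m -> F^o).
Proof.
have [a a0 Ma] := M_neq0; have La := ML Ma.
have mL := subring_submodule rL.
have [e le_e] := length_finite La a0.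
exists e.+1 => v; apply: contrapT => nrel.
have [d d0 [Ld Ldv]] := common_denominator v.
pose w i := d * v i.
have nrelw : ~ unit_relation (w : 'I_e.+1 -> F^o).
  move=> [c [Lc Mc wc]]; apply: nrel; exists c; split=> //; apply: (mulfI d0).
  rewrite mulr0 -[RHS]wc mulr_sumr; apply: eq_bigr => i _.
  by rewrite /GRing.scale /= mulrCA.
pose b := w ord0.
have b0 : b != 0.
  apply/eqP => b0; apply: nrelw; exists (fun i => if i == ord0 then 1 else 0); split.
  - by move=> i; case: eqP.
  - by exists ord0; rewrite eqxx.
  - by rewrite -[RHS]b0; apply: indicator_relation.
have [eb le_eb] := length_finite (Ldv ord0) b0.
pose V := [set x | exists2 c : 'I_e.+1 -> F, forall i, L (c i) & x = \sum_i c i * w i].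
have chV : chain L (scale_ideal a V) V e.+1 by apply: scalar_chain.
have chVn n : chain L (scale_ideal (a ^+ n) V) V (n * e.+1).
  elim: n => [|n IHn]; first by rewrite expr0 scale_ideal1; apply: chain_refl.
  rewrite mulSn; apply: chain_cat chV; rewrite exprS -scale_idealM.
  exact: chain_scale.
have le_n n : length_le L (scale_ideal (a ^+ n) (scale_ideal b L)) L (n * e + eb).
  elim: n => [|n IHn]; first by rewrite expr0 scale_ideal1.
  have anL : scale_ideal (a ^+ n) (scale_ideal b L) `<=` L.
    have Lan : L (a ^+ n) by elim: (n) => // k IHk; rewrite exprS; apply: LM.
    by move=> _ [_ [x Lx <-] <-]; apply: LM => //; apply: LM => //; apply: Ldv.
  rewrite mulSn -addnA addnC exprS -scale_idealM.
  have mab := submodule_scale (a ^+ n) (submodule_scale b mL).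
  apply: (length_le_cat (Y := scale_ideal a L)) => //.
  - exact: submodule_scale.
  - exact: submodule_scale.
  - exact: length_le_scale.
  - by move=> _ [x /anL Lx <-]; exists x.
  - by move=> _ [x Lx <-]; apply: LM.
(* For n = [eb] + 1 the lower bound n(e + 1) exceeds the upper bound n e + [eb] by one. *)
have := le_n eb.+1 (eb.+1 * e.+1)%N.
suff ch : chain L (scale_ideal (a ^+ eb.+1) (scale_ideal b L)) L (eb.+1 * e.+1).
  by move=> /(_ ch); rewrite mulnS addnC leq_add2l ltnn.
apply: chain_weakr (_ : V `<=` L).
  apply: chain_weakl (chVn _) _ => _ [_ [x Lx <-] <-]; exists (b * x) => //.
  exists (fun i => if i == ord0 then x else 0) => [i|]; first by case: eqP.
  by rewrite (bigD1 ord0) //= big1 ?addr0 1?mulrC // => i /negPf->; rewrite mul0r.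
move=> _ [c Lc ->]; elim/big_ind: _ => // [x y Lx Ly|i _].
  by have [_ LD _] := mL; apply: LD.
by apply: LM => //; apply: Ldv.
Qed.

Lemma unit_mul c d : L c -> L d -> ~ M c -> ~ M d -> ~ M (c * d).
Proof.
move=> Lc Ld Mc Md Mcd; apply: Md; have c0 : c != 0 by apply/eqP => c0; rewrite c0 in Mc.
by rewrite -(mulKf c0 d); case: mM => _ _ MZ; apply: MZ => //; apply: invM.
Qed.

(** Polynomials of size at most d stand for F^d, and the induction removes one coordinate: in each
    block of m vectors a unit relation kills the top coefficient, and the induction hypothesis
    relates the resulting combinations. Products of units keep a unit coefficient. *)
Lemma poly_relation d : exists T : finType, forall v : T -> {poly F},
  (forall t, (size (v t) <= d)%N) -> unit_relation v.
Proof.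
have [m rel_m] := scalar_relation; elim: d => [|d [T relT]].
  exists unit => v v0; exists (fun=> 1); split; [by [] | by exists tt |].
  by rewrite big1 // => t _; move: (v0 t); rewrite leqn0 size_poly_eq0 scale1r => /eqP.
exists (T * 'I_m)%type => v vd.
have [c cP] := choice (fun t => rel_m (fun i => (v (t, i))`_d)).
have [|e [Le [t0 Me] eu]] := relT (fun t => \sum_i c t i *: v (t, i)).
  move=> t; apply/leq_sizeP => j; rewrite leq_eqVlt => /orP[/eqP<-|ltdj].
    have [_ _ ct] := cP t; rewrite coef_sum -[RHS]ct.
    by apply: eq_bigr => i _; rewrite coefZ.
  rewrite coef_sum big1 // => i _; rewrite coefZ nth_default ?mulr0 //.
  exact: leq_trans (vd _) ltdj.
exists (fun p => e p.1 * c p.1 p.2); split.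
- by move=> [t i] /=; apply: LM => //; case: (cP t).
- have [Lc [i Mc] _] := cP t0; exists (t0, i) => /=.
  exact: unit_mul.
- rewrite -[RHS]eu; transitivity (\sum_t \sum_i (e t * c t i) *: v (t, i)).
    by rewrite pair_bigA; apply: eq_bigr => -[].
  apply: eq_bigr => t _; rewrite scaler_sumr.
  by apply: eq_bigr => i _; rewrite scalerA.
Qed.

(** A unit relation between the remainders modulo f of distinct powers of X is a multiple of f whose
    coefficients are those of the relation. *)
Lemma unit_multiple (f : {poly F}) : f != 0 -> exists s : {poly F},
  [/\ forall i, L s`_i, exists i, ~ M s`_i & f %| s].
Proof.
move=> f0; have [T relT] := poly_relation (size f).
have [|c [Lc [t0 Mc] crel]] := relT (fun t => 'X^(enum_rank t) %% f).
  by move=> t; apply/ltnW; rewrite ltn_modp.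
exists (\sum_t c t *: 'X^(enum_rank t)); split.
- move=> i; rewrite coef_sum; have [_ LD _] := subring_submodule rL.
  elim/big_ind: _ => // t _; rewrite coefZ coefXn; apply: LM => //.
  by case: eqP.
- exists (enum_rank t0); rewrite coef_sum (bigD1 t0) //= coefZ coefXn eqxx mulr1.
  rewrite big1 ?addr0 // => t tt0; rewrite coefZ coefXn.
  by rewrite val_eqE (inj_eq enum_rank_inj) eq_sym (negPf tt0) mulr0.
- rewrite /dvdp -[X in X == _](_ : \sum_t c t *: ('X^(enum_rank t) %% f) = _).
    by rewrite crel.
  rewrite (big_morph (fun p => p %% f) (modpD f) (mod0p f)).
  by apply: eq_bigr => t _; rewrite modpZl.
Qed.

End ChainLength.

(** * Localization at a height-one prime *)

Section Localization.
Variable F : fieldType.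
Local Open Scope classical_set_scope.
Local Open Scope ring_scope.
Variables D P : set F.
Hypotheses (rD : subring_set D) (pP : prime_set D P).

Definition localize (A : set F) : set F :=
  [set x | exists u, [/\ D u, ~ P u & A (u * x)]].

Let mD : submodule D D := subring_submodule rD.
Let mP : submodule D P. Proof. by case: pP. Qed.
Let PD : P `<=` D. Proof. by case: pP. Qed.
Let D1 : D 1. Proof. by case: rD. Qed.
Let P1 : ~ P 1. Proof. by case: pP. Qed.
Let DM x y : D x -> D y -> D (x * y). Proof. by case: rD => _ _; apply. Qed.
Let PM x y : D x -> D y -> ~ P x -> ~ P y -> ~ P (x * y).
Proof. by case: pP => _ _ _ PM Dx Dy Px Py /PM[]. Qed.

Lemma sub_localize A : A `<=` localize A.
Proof. by move=> x Ax; exists 1; rewrite mul1r. Qed.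

Lemma localize_mul A a x :
  submodule D A -> localize D a -> localize A x -> localize A (a * x).
Proof.
move=> [_ _ AM] [u [Du Pu Dua]] [v [Dv Pv Avx]].
by exists (u * v); split; [apply: DM | apply: PM | rewrite mulrACA; apply: AM].
Qed.

Lemma localize_submodule A : submodule D A -> submodule (localize D) (localize A).
Proof.
move=> mA; have [A0 AD AM] := mA; split.
- exact: sub_localize.
- move=> x y [u [Du Pu Aux]] [v [Dv Pv Avy]].
  exists (u * v); split; [exact: DM | exact: PM |].
  by rewrite mulrDr; apply: AD; [rewrite mulrAC mulrC | rewrite -mulrA]; apply: AM.
- by move=> a x; apply: localize_mul.
Qed.

Lemma localize_subring : subring_set (localize D).
Proof.
have [_ LD LM] := localize_submodule mD; split=> //; first exact: sub_localize.
move=> x y Lx Ly; apply: LD => //; rewrite -mulN1r; apply: LM => //.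
by apply: sub_localize; apply: (submoduleN rD mD).
Qed.

Lemma localize_prime_sub : localize P `<=` localize D.
Proof. by move=> x [u [Du Pu Pux]]; exists u; split=> //; apply: PD. Qed.

Lemma localize_prime1 : ~ localize P 1.
Proof. by move=> [u [_ Pu]]; rewrite mulr1. Qed.

Lemma localize_inv x : localize D x -> ~ localize P x -> localize D x^-1.
Proof.
move=> [u [Du Pu Dux]] Mx; exists (u * x); split=> // [Pux|].
  by apply: Mx; exists u.
rewrite mulfK //; apply/eqP => x0; apply: Mx; rewrite x0.
by apply: sub_localize; case: mP.
Qed.

Lemma localize_noetherian : noetherian_set D -> noetherian_set (localize D).
Proof.
move=> nD A [A0 AD AM] AL.
have [||s Es] := nD (A `&` D); last first.
- have sA x : x \in s -> A x by move=> /(sub_span rD); rewrite -Es => -[].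
  exists s; apply/seteqP; split; last by apply: span_min.
  move=> x Ax; have [u [Du Pu Dux]] := AL x Ax.
  have Lui : localize D u^-1.
    by apply: localize_inv (sub_localize Du) _ => -[v [Dv Pv]]; apply: PM.
  have u0 : u != 0 by apply/eqP => u0; apply: Pu; rewrite u0; case: mP.
  have: (A `&` D) (u * x) by split=> //; apply: AM => //; apply: sub_localize.
  rewrite Es => -[c Dc Eux]; exists (fun i => u^-1 * c i) => [i|].
    by apply: localize_mul => //; apply: sub_localize.
  rewrite -[LHS](mulKf u0) Eux mulr_sumr.
  by apply: eq_bigr => i _; rewrite mulrA.
- by move=> x [].
- apply: submoduleI => //; split=> // a x Da; apply: AM; exact: sub_localize.
Qed.

Lemma localize_denominators : has_denominators D -> has_denominators (localize D).
Proof.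
move=> qD x; have [d d0 [Dd Ddx]] := qD x.
by exists d => //; split; apply: sub_localize.
Qed.

Lemma localize_radical b x : noetherian_set D -> has_denominators D ->
  t_dim_one D -> t_ideal D P -> localize D b -> b != 0 -> localize P x ->
  exists n, scale_ideal b (localize D) (x ^+ n).
Proof.
move=> nD qD dD tP [u [Du Pu Dub]] b0 [v [Dv Pv Pvx]].
have u0 : u != 0 by apply/eqP => u0; apply: Pu; rewrite u0; case: mP.
have ub0 : u * b != 0 by rewrite mulf_neq0.
have [n [w [Dw Pw [y Dy Ey]]]] := t_prime_radical rD nD qD dD pP tP Dub ub0 Pvx.
exists n, (x ^+ n / b); last by rewrite mulrC divfK.
have Dvn k : D (v ^+ k) /\ ~ P (v ^+ k).
  elim: k => [|k [Dk Pk]]; first by rewrite expr0.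
  by rewrite exprS; split; [apply: DM | apply: PM].
have [Dn Pn] := Dvn n; exists (w * v ^+ n); split; [exact: DM | exact: PM |].
have -> : w * v ^+ n * (x ^+ n / b) = u * y.
  by rewrite mulrA -(mulrA w) -exprMn -Ey [u * b * y]mulrAC mulfK.
exact: DM.
Qed.

Lemma localize_poly (p : {poly F}) : (forall i, localize D p`_i) ->
  exists u, [/\ D u, ~ P u & forall i, D (u * p`_i)].
Proof.
move=> Lp; suff [u [Du Pu up]] : exists u, [/\ D u, ~ P u &
    forall i, (i < size p)%N -> D (u * p`_i)].
  exists u; split=> // i; have [/up//|le_i] := ltnP i (size p).
  by rewrite nth_default // mulr0; case: mD.
elim: (size p) => [|n [u [Du Pu up]]]; first by exists 1.
have [v [Dv Pv vp]] := Lp n; exists (u * v).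
split; [exact: DM | exact: PM | move=> i].
rewrite ltnS leq_eqVlt => /orP[/eqP->|/up Di]; first by rewrite -mulrA; apply: DM.
by rewrite mulrAC mulrC; apply: DM.
Qed.

Lemma multiple_prime_to (f : {poly F}) : noetherian_set D -> has_denominators D ->
  t_dim_one D -> t_ideal D P -> f != 0 ->
  exists p : {poly F}, [/\ forall i, D p`_i, exists i, ~ P p`_i & f %| p].
Proof.
move=> nD qD dD tP f0.
have M_neq0 : exists2 a, a != 0 & localize P a.
  by have [[_ [x x0 Px] _] _] := tP; exists x => //; apply: sub_localize.
have [p [Lp [i Mpi] fp]] := unit_multiple localize_subring (localize_submodule mP)
  localize_prime1 localize_inv (localize_noetherian nD)
  (fun b x => @localize_radical b x nD qD dD tP) localize_prime_sub M_neq0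
  (localize_denominators qD) f0.
have [u [Du Pu up]] := localize_poly Lp; exists (u *: p); split.
- by move=> j; rewrite coefZ.
- by exists i; rewrite coefZ => Pi; apply: Mpi; exists u.
- by rewrite -mul_polyC dvdp_mull.
Qed.

End Localization.

(** * Content formula and stability *)

Section DedekindMertens.
Variable F : fieldType.
Local Open Scope ring_scope.

(* An abstract form of the Dedekind-Mertens content formula: [N k] plays the  *)
(* role of the k-th power of the content of f in a ring where it is           *)
(* cancellable.                                                               *)
Lemma dedekind_mertens (N : nat -> set F) (f : {poly F}) :
  (forall k, N k 0) ->
  (forall k x y, N k x -> N k y -> N k (x - y)) ->
  (forall k l y, N k y -> N k.+1 (f`_l * y)) ->
  (forall k y, (forall l, N k.+1 (f`_l * y)) -> N k y) ->
  forall k (g : {poly F}), (forall i, N k (f * g)`_i) ->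
  forall i j, N k (f`_i * g`_j).
Proof.
move=> N0 NB Nmul Ndiv k g; move: (leqnn (size g)); move: {2}(size g) => n.
elim: n k g => [|n IHn] k g.
  by rewrite leqn0 size_poly_eq0 => /eqP-> _ i j; rewrite coef0 mulr0.
have ND k' x y : N k' x -> N k' y -> N k' (x + y).
  by move=> Nx Ny; rewrite -[y]opprK -[- y]sub0r; apply: (NB) => //; apply: NB.
move=> szg Nfg.
(* Descending induction on i: [p] bounds the distance from i to the size of f, beyond which f_i =
   0. *)
suff top p i : (size f <= i + p)%N -> forall j, N k (f`_i * g`_j).
  by move=> i; apply: (top (size f)); apply: leq_addl.
elim: p i => [|p IHp] i lei j.
  by rewrite (nth_default _ (_ : size f <= i)%N) ?mul0r // -[i]addn0.
(* In the coefficient of fg at i + n, the terms f_l g_{i+n-l} with l < i vanish and those with l > i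
   are covered by [IHp]. *)
have Nin : N k (f`_i * g`_n).
  have lti : (i < (i + n).+1)%N by rewrite ltnS leq_addr.
  have := Nfg (i + n)%N; rewrite coefM (bigD1 (Ordinal lti)) //= addKn.
  set r := \sum_(_ < _ | _) _ => Nr.
  suff Nr' : N k r by rewrite -[_ * _](addrK r); apply: NB.
  apply: (big_ind (N k)) => //; first exact: ND.
  move=> l; rewrite -val_eqE neq_ltn /= => /orP[ltl|gtl].
    rewrite [g`_ _]nth_default ?mulr0 //; apply: leq_trans szg _.
    by rewrite ltn_subRL ltn_add2r.
  apply: IHp; apply: leq_trans lei _.
  by rewrite addnS -addSn leq_add2r.
pose h := g - g`_n *: 'X^n.
have hE q : h`_q = g`_q - (if q == n then g`_n else 0).
  by rewrite coefB coefZ coefXn; case: eqP => _; rewrite ?mulr1 ?mulr0.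
have szh : (size (f`_i *: h) <= n)%N.
  apply: leq_trans (size_scale_leq _ _) _; apply/leq_sizeP => q.
  rewrite leq_eqVlt hE => /orP[/eqP<-|ltq]; first by rewrite eqxx subrr.
  rewrite nth_default ?(leq_trans szg) //.
  by rewrite eq_sym (ltn_eqF ltq) subrr.
(* Once its leading term is removed, f_i h is shorter than g, so the outer induction applies to it
   one level up; [Ndiv] then comes back down to level k. *)
have Nh l q : N k.+1 (f`_l * (f`_i *: h)`_q).
  apply: IHn => // {}q.
  have -> : (f * (f`_i *: h))`_q =
      f`_i * (f * g)`_q - (if (q < n)%N then 0 else f`_(q - n) * (f`_i * g`_n)).
    rewrite -scalerAr coefZ mulrBr coefB -scalerAr coefZ coefMXn mulrBr.
    case: ifP => _; rewrite ?mulr0 //; congr (_ - _).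
    by rewrite [RHS]mulrCA [f`_(q - n) * _]mulrC.
  by apply: (NB); [exact: Nmul | case: ifP => _; [exact: N0 | exact: Nmul]].
have Nih q : N k (f`_i * h`_q).
  by apply: Ndiv => l; have := Nh l q; rewrite coefZ.
have -> : g`_j = h`_j + (if j == n then g`_n else 0) by rewrite hE subrK.
by rewrite mulrDr; apply: ND => //; case: eqP => _; rewrite ?mulr0.
Qed.

End DedekindMertens.

Section StableIdeals.
Variable F : fieldType.
Local Open Scope classical_set_scope.
Local Open Scope ring_scope.
Implicit Types (D A B C I J K P : set F).

(** K is itself finitely generated, so it is one of the subideals in the union defining its
    t-closure. *)
Lemma noetherian_sub_t_closure D K : subring_set D -> noetherian_set D ->
  frac_ideal D K -> v_closure D K `<=` t_closure D K.
Proof.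
move=> rD nD fK x vx; exists K; split=> //.
exact: noetherian_frac_fin_gen.
Qed.

Lemma t_invertible_endo_colon D I : subring_set D -> frac_ideal D I ->
  let B := colon I I in
  t_invertible_in_endo I -> colon B (prod_ideal I (colon B I)) `<=` B.
Proof.
move=> rD [mI _ _] B tI x Cx; have [B1 _ _] := colon_subring mI rD.
have /t_closure_sub_v vB : t_closure B (prod_ideal I (colon B I)) 1 by rewrite tI.
by rewrite -[x]mul1r; apply: vB.
Qed.

(** J is finitely generated over D, hence over the larger ring B, so its t-closure over B contains
    its v-closure over B; the latter contains B because (B : J) is inside B. *)
Lemma colon_t_invertible_endo D I : subring_set D -> noetherian_set D ->
  frac_ideal D I -> let B := colon I I in
  colon B (prod_ideal I (colon B I)) `<=` B -> t_invertible_in_endo I.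
Proof.
move=> rD nD fI B CB; set J := prod_ideal I _ in CB; have [mI _ _] := fI.
have rB : subring_set B := colon_subring mI rD.
have DB : D `<=` B := sub_colon mI.
have fJ : frac_ideal D J.
  by apply: prod_ideal_frac => //; apply: colon_frac => //; apply: colon_frac.
have JB : J `<=` B.
  have [B0 BD _] := subring_submodule rB.
  by apply: prod_ideal_min => // x y Ix Cy; rewrite mulrC; apply: Cy.
have mBI : submodule B I by case: mI => I0 ID _; split=> // a x; apply.
have mBJ : submodule B J := submodule_prod _ mBI.
apply/seteqP; split=> b.
  by move=> /t_closure_sub_v vb; rewrite -[b]mulr1; apply: vb => y /JB; rewrite mul1r.
move=> Bb; exists J; split=> //.
- split=> //; first by case: fJ.
  exists 1; rewrite ?oner_eq0 //; split; first by case: rB.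
  by move=> x /JB; rewrite mul1r.
- have [s Es] := noetherian_frac_fin_gen rD nD fJ.
  exists s; apply/seteqP; split.
    by rewrite Es => _ [c Dc ->]; exists c => // i; apply: DB.
  by apply: span_min => // x xs; rewrite Es; apply: sub_span.
- move=> u Cu; have [_ _ BM] := rB; apply: BM => //; exact: CB.
Qed.

Lemma t_invertible_endo_L_stable D I : subring_set D -> frac_ideal D I ->
  t_invertible_in_endo I -> L_stable I.
Proof.
move=> rD fI tI; have [mI _ _] := fI; have rB := colon_subring mI rD.
have CB := t_invertible_endo_colon rD fI tI.
have [B1 _ BM] := rB; have [B0 BD _] := subring_submodule rB.
move: rB CB B1 BM B0 BD; set B := colon I I => rB CB B1 BM B0 BD.
pose C := colon B I.
(* Each use of [CB] removes one factor J = IC; index n stands for the power n + 1, so n + 1 uses are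
   needed. *)
have pow_cancel n u :
    (forall p q, pow_ideal I n p -> pow_ideal C n q -> B (u * (p * q))) -> B u.
  elim: n u => [|n IHn] u Bu; apply: CB => y.
    apply: (prod_ideal_min (M := [set y | B (u * y)])) => /=.
    - by rewrite mulr0.
    - by move=> x z; rewrite mulrDr; apply: BD.
    - exact: Bu.
  apply: (prod_ideal_min (M := [set y | B (u * y)])) => /=.
  - by rewrite mulr0.
  - by move=> x z; rewrite mulrDr; apply: BD.
  move=> i c Ii Cc; apply: IHn => p q Ip Cq.
  by rewrite -mulrA [i * c * _]mulrC mulrACA; apply: Bu; apply: mem_prod_ideal.
have pow_B n p q : pow_ideal I n p -> pow_ideal C n q -> B (p * q).
  elim: n p q => [|n IHn] p q; first by move=> Ip Cq; rewrite mulrC; apply: Cq.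
  move=> Ip Cq; move: p Ip.
  apply: (prod_ideal_min (M := [set p | B (p * q)])) => /=.
  - by rewrite mul0r.
  - by move=> x z; rewrite mulrDl; apply: BD.
  move=> p i Ip Ii; move: q Cq.
  apply: (prod_ideal_min (M := [set q | B (p * i * q)])) => /=.
  - by rewrite mulr0.
  - by move=> x z; rewrite mulrDr; apply: BD.
  move=> q c Cq Cc; rewrite mulrACA; apply: BM; first exact: IHn.
  by rewrite mulrC; apply: Cc.
apply/seteqP; split=> [x [n _ xn]|x Bx]; last by exists 0%N.
by apply: (pow_cancel n) => p q Ip Cq; rewrite mulrA; apply: (pow_B n) => //; apply: xn.
Qed.

Lemma L_stable_prod_prime_to D I P : subring_set D -> noetherian_set D ->
  has_denominators D -> t_dim_one D -> prime_set D P -> t_ideal D P ->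
  frac_ideal D I -> L_stable I ->
  exists2 r, D r /\ ~ P r & prod_ideal I (colon (colon I I) I) r.
Proof.
move=> rD nD qD dD pP tP fI stI; have [mI [x0 x00 Ix0] _] := fI.
have [I0 ID IM] := mI.
have [s Es] := noetherian_frac_fin_gen rD nD fI.
pose f := Poly s.
have Is l : I f`_l.
  rewrite coef_Poly; have [lts|/(nth_default 0)->//] := ltnP l (size s).
  by rewrite Es; apply: sub_span => //; apply: mem_nth.
have f0 : f != 0.
  apply: contraNneq x00 => f0; move: Ix0; rewrite Es => -[c _ ->].
  by rewrite big1 // => i _; rewrite -coef_Poly -/f f0 coef0 mulr0.
have [p [Dp [i Pi] /dvdpP[g Ep]]] := multiple_prime_to rD pP nD qD dD tP f0.
have mpow n : submodule D (pow_ideal I n) := submodule_pow n mI.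
(* N k is the union over r of (I^(r+k) : I^r), so L-stability says that N 0   *)
(* is (I : I); the indices of pow_ideal are shifted by one, hence r >= 1.     *)
pose N k := [set y | exists r, forall z, pow_ideal I r z -> pow_ideal I (r + k) (y * z)].
have Nup k y r r' : (r <= r')%N ->
    (forall z, pow_ideal I r z -> pow_ideal I (r + k) (y * z)) ->
    forall z, pow_ideal I r' z -> pow_ideal I (r' + k) (y * z).
  move=> /subnK <- yr; elim: (r' - r)%N => [//|n IHn].
  rewrite addSn => z.
  apply: (prod_ideal_min
    (M := [set z | pow_ideal I ((n + r).+1 + k) (y * z)])) => /=.
  - by rewrite mulr0; apply: prod_ideal0.
  - by move=> u v; rewrite mulrDr; apply: prod_idealD.
  - by move=> u v Iu Iv; rewrite mulrA; apply: mem_prod_ideal => //; apply: IHn.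
have fg : forall l j, N 0%N (f`_l * g`_j).
  apply: (@dedekind_mertens F N f).
  - by move=> k; exists 0%N => z _; rewrite mul0r; case: (mpow (0 + k)%N).
  - move=> k x y [r xr] [r' yr']; exists (maxn r r') => z Iz; rewrite mulrBl.
    apply: (submoduleB rD (mpow _)).
      exact: (Nup _ _ _ _ (leq_maxl _ _) xr).
    exact: (Nup _ _ _ _ (leq_maxr _ _) yr').
  - move=> k l y [r yr]; exists r => z Iz; rewrite addnS -mulrA mulrC.
    by apply: mem_prod_ideal => //; apply: yr.
  (* Each generator f_l of I comes with its own exponent; their maximum [m] serves all of them. One
     further factor from I, expanded in the generators, supplies the f_l, hence [m.+1]. *)
  - move=> k y yP; have [r rP] := choice yP.
    pose m := \max_(l < size s) r l; exists m.+1 => z.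
    apply: (prod_ideal_min (M := [set z | pow_ideal I (m.+1 + k) (y * z)])) => /=.
    + by rewrite mulr0; case: (mpow (m.+1 + k)%N).
    + by move=> u v; rewrite mulrDr; case: (mpow (m.+1 + k)%N) => _ + _; apply.
    + move=> u v Iu; rewrite [X in X v]Es => -[c Dc ->]; rewrite mulrA mulr_sumr.
      apply: (@submodule_sum F D _ _ (fun l => y * u * (c l * s`_l)) (mpow (m.+1 + k)%N)) => // l lts.
      have -> : y * u * (c l * s`_l) = c l * (f`_l * y * u).
        by rewrite -(coef_Poly s l) -/f mulrCA [y * u * _]mulrC -[f`_l * y * u]mulrA.
      have [_ _ MM] := mpow (m.+1 + k)%N; apply: MM => //.
      rewrite addSnnS; apply: (Nup _ _ _ _ _ (rP l)) Iu.
      exact: (leq_bigmax (Ordinal lts)).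
  - move=> j; exists 0%N => z Iz; apply: IM => //.
    by rewrite mulrC -Ep.
(* By [fg] and L-stability every f_l g_j lies in (I : I), and the f_l generate I. *)
have Cg j : colon (colon I I) I g`_j.
  have mB := submodule_colon I mI.
  move=> y; rewrite [X in X y]Es => -[c Dc ->]; rewrite mulr_sumr.
  apply: (@submodule_sum F D _ _ (fun l => g`_j * (c l * s`_l)) mB) => // l lts.
  have -> : g`_j * (c l * s`_l) = c l * (f`_l * g`_j).
    by rewrite -(coef_Poly s l) -/f mulrCA [g`_j * _]mulrC.
  have [_ _ MB] := mB; apply: MB => //; rewrite -stI.
  by have [r rP] := fg l j; exists r => // z; rewrite -{2}[r]addn0; apply: rP.
exists p`_i => //; rewrite Ep coefM.
have [P0 PD _] := submodule_prod (colon (colon I I) I) mI.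
elim/big_ind: _ => // j _; rewrite mulrC; exact: mem_prod_ideal.
Qed.

Lemma L_stable_sub_t_closure D I : subring_set D -> noetherian_set D ->
  has_denominators D -> t_dim_one D -> frac_ideal D I -> L_stable I ->
  I `<=` t_closure D (prod_ideal (colon (colon I I) I) (prod_ideal I I)).
Proof.
move=> rD nD qD dD fI stI y Iy; set C := colon _ I.
have fC : frac_ideal D C by apply: colon_colon_frac.
have fK := prod_ideal_frac rD fC (prod_ideal_frac rD fI fI).
apply: (noetherian_sub_t_closure rD nD fK) => z Kz; apply: contrapT => nDyz.
have [w [pP yzw]] := prime_over_residual rD nD nDyz.
have tP := residual_ideal w rD qD.
have [r [Dr nPr] Jr] := L_stable_prod_prime_to rD nD qD dD pP tP fI stI.
apply/nPr/yzw; split=> //; have [D0 DD _] := subring_submodule rD.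
move: r Jr {Dr nPr}.
apply: (prod_ideal_min (M := [set r | D (r * (y * z))])) => /=.
- by rewrite mul0r.
- by move=> u v; rewrite mulrDl; apply: DD.
move=> i c Ii Cc; have -> : i * c * (y * z) = z * (c * (i * y)).
  by rewrite mulrA mulrC [i * c]mulrC -mulrA.
by apply: Kz; do 2!apply: mem_prod_ideal => //.
Qed.

End StableIdeals.

(** * The t-class semigroup of a Noetherian domain *)

Section BaseRing.
Variable R : idomainType.
Local Open Scope classical_set_scope.
Local Open Scope ring_scope.
Local Notation F := {fraction R}.
Local Notation D := (base_ring R).
Local Notation tofrac := (@FracField.tofrac R).
Implicit Types (I A P Q : set F).

Lemma base_ring_denominators : has_denominators D.
Proof.
move=> x; exists (tofrac (\d_(repr x))).
  by rewrite tofrac_eq0; exact: denom_ratioP.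
split; first by exists (\d_(repr x)).
exists (\n_(repr x)) => //; rewrite -[in RHS](reprK x).
rewrite !piE; apply/eqmodP => /=; rewrite FracField.equivfE !numden_Ratio ?mulf_neq0 ?oner_neq0 ?denom_ratioP //.
by rewrite reprK !mul1r mulrC.
Qed.

Lemma preimage_ideal A : submodule D A -> ideal (tofrac @^-1` A).
Proof.
move=> [A0 AD AM]; split=> /=; first by rewrite tofrac0.
  by move=> x y; rewrite tofracD; apply: AD.
by move=> a x; rewrite tofracM; apply: AM; exists a.
Qed.

Lemma image_preimage_base A : A `<=` D -> tofrac @` (tofrac @^-1` A) = A.
Proof.
move=> AD; apply/seteqP; split=> [_ [r Ar <-]//|x Ax].
by have [r _ rx] := AD x Ax; exists r; rewrite //= rx.
Qed.

Lemma base_ring_noetherian : noetherian R -> noetherian_set D.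
Proof.
move=> nR A mA AD; have [s Es] := nR _ (preimage_ideal mA).
have As x : x \in s -> A (tofrac x).
  move=> xs; suff: (tofrac @^-1` A) x by [].
  rewrite Es; exists (fun i => if i == index x s then 1 else 0).
  have xs' : (index x s < size s)%N by rewrite index_mem.
  rewrite (bigD1 (Ordinal xs')) //= eqxx mul1r nth_index // big1 ?addr0 // => i.
  by rewrite -val_eqE /= => /negPf->; rewrite mul0r.
exists (map tofrac s); apply/seteqP; split; last first.
  by apply: span_min => // _ /mapP[x xs ->]; apply: As.
move=> x Ax; have [r _ rx] := AD x Ax.
have: (tofrac @^-1` A) r by rewrite /= rx.
rewrite Es => -[c Ec]; exists (fun i => tofrac (c i)) => [i|]; first by exists (c i).
rewrite -rx Ec rmorph_sum size_map; apply: eq_bigr => i _.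
by rewrite /= tofracM (nth_map 0).
Qed.

Lemma base_ring_t_prime P : prime_set D P -> t_ideal D P ->
  t_prime (tofrac @^-1` P).
Proof.
move=> [mP PD P1 PM] tP; split; last by rewrite image_preimage_base.
- split; [exact: preimage_ideal | by rewrite /= tofrac1 |].
  by move=> a b /=; rewrite tofracM; apply: PM; [exists a | exists b].
- have [[_ [x x0 Px] _] _] := tP; have [r _ rx] := PD x Px.
  by exists r; [rewrite -tofrac_eq0 rx | rewrite /= rx].
Qed.

Lemma base_ring_t_dim : t_dim_eq R 1 -> t_dim_one D.
Proof.
move=> [_ dR] P Q pP pQ tP tQ QP; apply: contrapT => nPQ.
pose f i := if i is i'.+1 then if i' is _.+1 then tofrac @^-1` P else tofrac @^-1` Q else [set 0].
suff /dR : t_prime_chain 2 f by [].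
split=> // [[|[|i]]//= _|[|[|//]] _ /=].
- exact: base_ring_t_prime.
- exact: base_ring_t_prime.
- have [_ [r r0 Qr] _] := base_ring_t_prime pQ tQ.
  split=> [_ ->|Q0] /=; first by rewrite tofrac0; case: pQ => [[]].
  by have /eqP := Q0 r Qr; rewrite (negPf r0).
- split=> [r /=|PQ]; first exact: QP.
  have [_ PD _ _] := pP; apply: nPQ => x Px; have [r _ rx] := PD x Px.
  by rewrite -rx; apply: PQ; rewrite /= rx.
Qed.

Lemma clifford_t_invertible : noetherian R -> clifford_t_regular R ->
  forall I, t_ideal D I -> t_invertible_in_endo I.
Proof.
move=> nR [_ clR] I tI; have [fI EI] := tI; have rD := base_ring_subring R.
have nD := base_ring_noetherian nR; have [mI _ _] := fI.
apply: (colon_t_invertible_endo rD nD fI) => x Cx y Iy.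
set X := TIdeal tI; have [a] := clR (\pi_(tClass R)%qT X).
rewrite -[a]reprK; move: (repr a) => A.
rewrite [RHS](_ : _ = tClass_mul (\pi A)%qT (tClass_mul (\pi X)%qT (\pi X)%qT)) //.
rewrite (tClass_mul_pi X X) (tClass_mul_pi A) => /eqmodP/asboolP[c c0 /= Ec].
have fA : frac_ideal D A := tIdeal_frac A.
have fII := prod_ideal_frac rD fI fI.
(* The Clifford equation reads cI = (A(I^2)_t)_t, so c^{-1} A I^2 is inside I, that is, c^{-1} A is
   inside (B : I). *)
have AII b i j : tIdeal_set A b -> I i -> I j -> I (c^-1 * (b * (i * j))).
  move=> Ab Ii Ij; have : t_prod D A (t_prod D I I) (b * (i * j)).
    apply: sub_t_closure => //.
      by apply: prod_ideal_frac => //; apply: t_closure_frac.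
    by apply: mem_prod_ideal => //; apply: sub_t_closure => //; apply: mem_prod_ideal.
  by rewrite Ec => -[z Iz <-]; rewrite mulKf.
have : t_prod D A (t_prod D I I) (c * y) by rewrite Ec; exists y.
move=> /t_closure_sub_v vy; rewrite -EI.
apply: (noetherian_sub_t_closure rD nD fI) => z Iz.
(* As cy lies in the v-closure of A(I^2)_t, it suffices that xz/c maps A I^2 into D. It does: c^{-1}
   A I is inside J, x maps J into B, and z maps I into D. *)
have -> : x * y * z = c * y * (x / c * z).
  by rewrite mulrACA [c * _]mulrC divfK // mulrA.
have [D0 DD _] := subring_submodule rD; apply: vy.
apply: (prod_ideal_min (M := [set p | D (x / c * z * p)])) => /=.
- by rewrite mulr0.
- by move=> u v; rewrite mulrDr; apply: DD.
move=> b q Ab /t_closure_sub_v vq; rewrite mulrA mulrC; apply: vq.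
apply: (prod_ideal_min (M := [set p | D (x / c * z * b * p)])) => /=.
- by rewrite mulr0.
- by move=> u v; rewrite mulrDr; apply: DD.
move=> i j Ii Ij.
have -> : x / c * z * b * (i * j) = z * (x * (i * (c^-1 * b)) * j).
  rewrite [x / c * z]mulrC -!mulrA; congr (_ * (_ * _)).
  by rewrite [RHS]mulrCA; congr (_ * _); rewrite mulrCA.
apply: Iz; apply: Cx => //; apply: mem_prod_ideal => // k Ik l Il.
by rewrite -!mulrA; apply: AII.
Qed.

Lemma L_stable_clifford : noetherian R -> t_dim_eq R 1 ->
  (forall I, t_ideal D I -> L_stable I) -> clifford_t_regular R.
Proof.
move=> nR dR stR; split; first exact: tClass_mulC.
have rD := base_ring_subring R; have nD := base_ring_noetherian nR.
move=> x; rewrite -[x]reprK; move: (repr x) => [I tI] {x}.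
have [fI EI] := tI; set X := TIdeal tI.
have fC := colon_colon_frac rD fI; set C := colon _ I in fC.
(* With the class of C_t, where C = (B : I), the Clifford equation becomes I = (C I^2)_t. *)
exists (\pi_(tClass R)%qT (TIdeal (t_closure_ideal rD fC))); set Y := TIdeal _.
rewrite [RHS](_ : _ = tClass_mul (\pi Y)%qT (tClass_mul (\pi X)%qT (\pi X)%qT)) //.
rewrite (tClass_mul_pi X X) (tClass_mul_pi Y); congr (\pi_(tClass R)%qT _); apply: tIdeal_inj => /=.
have fII := prod_ideal_frac rD fI fI.
rewrite t_prod_closure //; last exact: t_closure_frac.
rewrite t_prodC t_prod_closure // /t_prod prod_idealC.
apply/seteqP; split.
  by apply: L_stable_sub_t_closure (stR I tI) => //;
    [exact: base_ring_denominators | exact: base_ring_t_dim].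
rewrite -[X in _ `<=` X]EI; apply: t_closure_mono.
have [[I0 ID IM] _ _] := fI.
apply: prod_ideal_min => // c z Cc; move: z.
apply: (prod_ideal_min (M := [set z | I (c * z)])) => /=.
- by rewrite mulr0.
- by move=> u v; rewrite mulrDr; apply: ID.
by move=> i j Ii Ij; rewrite mulrA; apply: Cc.
Qed.

End BaseRing.

Theorem theorem2p2 (R : idomainType) (noethR : noetherian R) :
  (clifford_t_regular R ->
     forall I : set {fraction R},
       t_ideal (base_ring R) I -> t_invertible_in_endo I) /\
  ((forall I : set {fraction R},
       t_ideal (base_ring R) I -> t_invertible_in_endo I) ->
     forall I : set {fraction R}, t_ideal (base_ring R) I -> L_stable I) /\
  (t_dim_eq R 1 ->
     (forall I : set {fraction R}, t_ideal (base_ring R) I -> L_stable I) ->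
     clifford_t_regular R).
Proof.
split; first exact: clifford_t_invertible.
split; last exact: L_stable_clifford.
move=> tI I tidI; have [fI _] := tidI.
exact: t_invertible_endo_L_stable (base_ring_subring R) fI (tI I tidI).
Qed.
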